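(* Let $\theta\in(0,\frac{\pi}{2})$ and let $M$ be a constant angle surface in $\mathbb{S}^3(1)\times\mathbb{R}$ with constant angle $\theta$. If the mean curvature vector $\vec{H}$ of $M$ in $\mathbb{S}^3(1)\times\mathbb{R}$ is parallel in the normal bundle, i.e. $\nabla^{\perp}\vec{H}=0$, then $\vec{H}=0$; that is, $M$ is a minimal surface in $\mathbb{S}^3(1)\times\mathbb{R}$.
   Context: $\mathbb{S}^3(1)\times\mathbb{R}$ is the Riemannian product of the unit $3$-sphere and the real line, $t$ is the global coordinate on $\mathbb{R}$, and $\partial_t=\frac{\partial}{\partial t}$ is the unit vector field tangent to the $\mathbb{R}$-direction. A surface $M$ in $\mathbb{S}^3(1)\times\mathbb{R}$ is a (smooth) immersed two-dimensional submanifold with the induced metric. Along $M$ one decomposes $$\partial_t=\sin\theta\, T+\cos\theta\,\xi,$$ where $T$ is a unit vector tangent to $M$, $\xi$ is a unit vector normal to $M$, and $\theta\in[0,\frac{\pi}{2}]$ is the angle between $\xi$ and $\partial_t$ (the angle between $\partial_t$ and the normal plane of $M$). $M$ is called a constant angle surface (with constant angle $\theta$) if the angle function $\theta$ is constant on $M$. Here $h$ denotes the second fundamental form of $M$ in $\mathbb{S}^3(1)\times\mathbb{R}$, $\nabla^{\perp}$ the normal connection, and $\vec{H}=\frac12\operatorname{trace} h$ the mean curvature vector; $M$ is minimal if $\vec{H}=0$. *)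

(* Defs.v *)
From HB Require Import structures.
From mathcomp Require Import all_boot all_order all_algebra.
From mathcomp Require Import all_classical all_reals all_analysis.
Set Implicit Arguments.
Unset Strict Implicit.
Unset Printing Implicit Defensive.
Import Order.TTheory GRing.Theory Num.Theory.
Import numFieldNormedType.Exports.
Local Open Scope classical_set_scope.
Local Open Scope ring_scope.

Fixpoint iterD (R : realType) (V W : normedModType R) (s : seq V) (f : V -> W)
    : V -> W :=
  if s is v :: s' then fun x => 'D_v (iterD s' f) x else f.

(* Infinite differentiability: every iterated directional derivative is
   Frechet differentiable at every point of [U].  Only used for open [U], where
   it does not depend on the values of [f] outside [U]. *)
Definition smooth_on (R : realType) (V W : normedModType R)
    (U : set V) (f : V -> W) :=
  forall (s : seq V) (x : V), U x -> differentiable (iterD s f) x.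

Record smooth_atlas (R : realType) (M : topologicalType) := SmoothAtlas {
  chart_index : Type;
  chart_dom : chart_index -> set M;
  chart : chart_index -> M -> 'rV[R]_2;
  chart_inv : chart_index -> 'rV[R]_2 -> M;
  chart_dom_open : forall i, open (chart_dom i);
  chart_img_open : forall i, open (chart i @` chart_dom i);
  chartK : forall i, {in chart_dom i, cancel (chart i) (chart_inv i)};
  chart_continuous : forall i, {within chart_dom i, continuous (chart i)};
  chart_inv_continuous : forall i,
    {within chart i @` chart_dom i, continuous (chart_inv i)};
  chart_cover : \bigcup_i chart_dom i = [set: M];
  chart_transition : forall i j,
    smooth_on (chart i @` (chart_dom i `&` chart_dom j))
              (chart j \o chart_inv i)
}.

Definition chart_img (R : realType) (M : topologicalType)
    (A : smooth_atlas R M) (i : chart_index A) : set 'rV[R]_2 :=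
  chart i @` chart_dom i.

Definition dotv (R : realType) (n : nat) (u v : 'rV[R]_n) : R :=
  (u *m v^T) 0 0.

(* The space [S^3(1) x R] sits in Euclidean space [R^4 x R = R^(4+1)], whose
   scalar product induces the Riemannian product metric. *)
Definition in_S3xR (R : realType) (p : 'rV[R]_(4 + 1)) :=
  dotv (lsubmx p) (lsubmx p) = 1.

Definition dt (R : realType) : 'rV[R]_(4 + 1) := row_mx 0 1.

(* Unit normal of [S^3(1) x R] in [R^(4+1)] at [p]. *)
Definition nuS3xR (R : realType) (p : 'rV[R]_(4 + 1)) : 'rV[R]_(4 + 1) :=
  row_mx (lsubmx p) 0.

(* Orthogonal projection to the tangent space of [S^3(1) x R] at [p]. *)
Definition projS3xR (R : realType) (p w : 'rV[R]_(4 + 1)) : 'rV[R]_(4 + 1) :=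
  w - dotv w (nuS3xR p) *: nuS3xR p.

Definition partial (R : realType) (V : normedModType R)
    (F : 'rV[R]_2 -> V) (i : 'I_2) (x : 'rV[R]_2) : V :=
  'D_(delta_mx 0 i) F x.

Section LocalGeometry.
Variables (R : realType) (F : 'rV[R]_2 -> 'rV[R]_(4 + 1)).

Definition frame (x : 'rV[R]_2) : 'M[R]_(2, 4 + 1) :=
  \matrix_(i < 2) partial F i x.

Definition metric (x : 'rV[R]_2) : 'M[R]_2 := frame x *m (frame x)^T.

Definition tangent_vec (x : 'rV[R]_2) (w : 'rV[R]_(4 + 1)) :=
  (w <= frame x)%MS.

Definition normal_vec (x : 'rV[R]_2) (w : 'rV[R]_(4 + 1)) :=
  dotv w (nuS3xR (F x)) = 0 /\ forall i, dotv w (partial F i x) = 0.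

(* With the rows of [J = frame x] spanning the tangent plane, this is the
   orthogonal projection [w J^T (J J^T)^-1 J] of [w] to that plane. *)
Definition tangent_part (x : 'rV[R]_2) (w : 'rV[R]_(4 + 1)) :=
  w *m (frame x)^T *m invmx (metric x) *m frame x.

(* For [w] tangent to [S^3(1) x R] at [F x], the component of [w] in the normal
   plane [normal_vec x] of the surface in [S^3(1) x R]; it is only applied to
   such [w]. *)
Definition normal_part (x : 'rV[R]_2) (w : 'rV[R]_(4 + 1)) :=
  w - tangent_part x w.

(* Levi-Civita connection of [S^3(1) x R], along [F] and in the [i]-th
   coordinate direction: the component of the flat derivative tangent to
   [S^3(1) x R]. *)
Definition cov_deriv (V : 'rV[R]_2 -> 'rV[R]_(4 + 1)) (i : 'I_2)
    (x : 'rV[R]_2) := projS3xR (F x) (partial V i x).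

(* [h(d_i, d_j)], in the coordinate frame. *)
Definition second_ff (i j : 'I_2) (x : 'rV[R]_2) :=
  normal_part x (cov_deriv (partial F j) i x).

(* Half the trace of [h] with respect to the induced metric. *)
Definition mean_curvature (x : 'rV[R]_2) :=
  2^-1 *: \sum_i \sum_j invmx (metric x) i j *: second_ff i j x.

Definition normal_conn (N : 'rV[R]_2 -> 'rV[R]_(4 + 1)) (i : 'I_2)
    (x : 'rV[R]_2) := normal_part x (cov_deriv N i x).

Definition has_angle (theta : R) (x : 'rV[R]_2) :=
  0 <= theta <= pi / 2 /\
  exists T xi : 'rV[R]_(4 + 1),
    [/\ tangent_vec x T, dotv T T = 1, normal_vec x xi, dotv xi xi = 1 &
        dt R = sin theta *: T + cos theta *: xi].

End LocalGeometry.

Section ImmersedSurface.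
Variables (R : realType) (M : topologicalType) (A : smooth_atlas R M).
Variable f : M -> 'rV[R]_(4 + 1).

Definition local_param (i : chart_index A) : 'rV[R]_2 -> 'rV[R]_(4 + 1) :=
  f \o chart_inv i.

Definition immersed_surface :=
  [/\ hausdorff_space M, @second_countable M, forall p, in_S3xR (f p) &
      forall i, smooth_on (chart_img i) (local_param i) /\
        forall x, chart_img i x -> \rank (frame (local_param i) x) = 2%N].

(* The objects in the next three definitions depend only on the point of [M],
   not on the chart around it used to express them. *)
Definition constant_angle (theta : R) :=
  forall i x, chart_img i x -> has_angle (local_param i) theta x.

Definition parallel_mean_curvature :=
  forall i x, chart_img i x ->
    forall k, normal_conn (local_param i)
                          (mean_curvature (local_param i)) k x = 0.

Definition minimal :=
  forall i x, chart_img i x -> mean_curvature (local_param i) x = 0.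

End ImmersedSurface.

(* Main.v *)
Require Import Defs.
From mathcomp Require Import all_boot all_order all_algebra.
From mathcomp Require Import all_classical all_reals all_analysis.
From mathcomp Require Import ring lra.
Import Order.TTheory GRing.Theory Num.Theory.
Local Open Scope classical_set_scope.
Local Open Scope ring_scope.
Set Implicit Arguments.
Unset Strict Implicit.
Unset Printing Implicit Defensive.
Import numFieldNormedType.Exports.

(** Write [s] and [c] for the sine and cosine of the angle.  On a chart let [X] be
    the unit tangent field [T] of the decomposition of the vertical vector and
    [Y] the unit tangent field orthogonal to it.  The height has derivative [s]
    along [X] and [0] along [Y], so the projection of the surface to the sphere
    maps [X] to [c] times a unit vector and [Y] to a unit vector orthogonal to
    it.  The position in the sphere, these two unit vectors and their vector
    product form an orthonormal frame of R^4 along the surface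
    ([orthonormal_adapted_frame]).

    Commuting derivatives on the height and on the position leaves four unknown
    entries [y], [a], [b], [n] in the connection of this frame and shows that
    the bracket of [X] and [Y] is [- c y Y] ([symmetry_relations]).  In the
    orthonormal normal basis [xi], [eta], with [eta] horizontal, twice the mean
    curvature vector is [s y xi + sg eta] where [sg = c a + n]
    ([mean_curvature_expansion]).  That it is parallel gives
    [X y = - a sg], [Y y = - b sg], [X sg = s^2 y a] and [Y sg = s^2 y b]
    ([parallel_transport]).

    Substituted into the Gauss equation this gives [a^2 + b^2 = 1 + y^2]
    ([gauss_parallel]).  Commuting derivatives on [sg] and using a Codazzi
    equation gives [y b = 0] ([flat_normal_bundle]).  Suppose [y] is nonzero at
    a point.  Then [b] and its derivative along [Y] vanish there;
    differentiating [a^2 + b^2 = 1 + y^2] and comparing with the other Codazzi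
    equation gives [n = 0] ([connection_Y23_eq0]), and one more derivative gives
    [y a = 0], so that [a = b = 0], a contradiction ([connection_Y12_eq0]).
    Hence [y] vanishes identically, its derivatives give [a sg = b sg = 0], and
    since [a^2 + b^2 = 1] also [sg = 0].

    All fields must be differentiated several times, which is why they are given
    by explicit formulas in the coordinate derivatives of the immersion, and
    commuting derivatives rests on the symmetry of second derivatives
    ([partialC]). *)

(** * Smooth functions on an open subset of the plane *)

Section SmoothFunctions.
Context {R : realType} (U : set 'rV[R]_2).
Hypothesis openU : open U.
Implicit Types (f g : 'rV[R]_2 -> R) (x : 'rV[R]_2) (n : nat).

(** Only coordinate derivatives enter, and continuity is recorded separately
    because it does not follow from the existence of directional derivatives.
    Grading by [n] makes closure under products, inverses and square roots an
    induction: the derivative of each is built from functions of lower order.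
    *)
Fixpoint Cn n g : Prop :=
  if n is n'.+1 then
    (forall x, U x -> g @ x --> g x /\
                      forall i : 'I_2, derivable g x (delta_mx 0 i)) /\
    (forall i, Cn n' (partial g i))
  else True.

Definition Cinf g := forall n, Cn n g.

Lemma near_on f g x : (forall y, U y -> f y = g y) -> U x ->
  {near x, f =1 g}.
Proof.
by move=> fg Ux; apply: filterS fg _; exact: open_nbhs_nbhs.
Qed.

Lemma partial_eq f g i x : (forall y, U y -> f y = g y) -> U x ->
  partial f i x = partial g i x.
Proof. by move=> fg Ux; apply: near_eq_derive; exact: near_on. Qed.

(** Smoothness on an open set only sees the values there, so derivatives may
    be computed from any formula valid on [U]. *)
Lemma Cn_eq n f g : (forall y, U y -> f y = g y) -> Cn n f -> Cn n g.
Proof.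
elim: n f g => //= n IH f g fg [df Df]; split=> [x Ux|i].
  have [cf derf] := df x Ux; have nfg := near_on fg Ux.
  split=> [|i]; last exact: near_eq_derivable (derf i).
  by rewrite -(fg x Ux); apply: (cvg_trans _ cf); exact: (near_eq_cvg nfg).
by apply: IH (Df i) => y Uy; exact: partial_eq.
Qed.

Lemma CnW n g : Cn n.+1 g -> Cn n g.
Proof.
elim: n g => // n IH g [dg Dg]; split=> // i; exact: IH.
Qed.

Lemma Cn_cst n (c : R) : Cn n (fun=> c).
Proof.
elim: n c => //= n IH c; split=> [x _|i].
  by split; [apply: cst_continuous|move=> i; exact: derivable_cst].
by apply: Cn_eq (IH 0) => y _; rewrite /partial derive_cst.
Qed.

Lemma partialD f g i x : derivable f x (delta_mx 0 i) ->
  derivable g x (delta_mx 0 i) ->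
  partial (fun y => f y + g y) i x = partial f i x + partial g i x.
Proof. exact: deriveD. Qed.

Lemma partialM f g i x : derivable f x (delta_mx 0 i) ->
  derivable g x (delta_mx 0 i) ->
  partial (fun y => f y * g y) i x = partial f i x * g x + f x * partial g i x.
Proof.
move=> df dg; rewrite [LHS](deriveM df dg) addrC; congr (_ + _).
exact: mulrC.
Qed.

Lemma CnD n f g : Cn n f -> Cn n g -> Cn n (fun x => f x + g x).
Proof.
elim: n f g => //= n IH f g [df Df] [dg Dg]; split=> [x Ux|i].
  have [cf derf] := df x Ux; have [cg derg] := dg x Ux.
  by split=> [|i]; [apply: (cvgD cf cg)|exact: (derivableD (derf i) (derg i))].
apply: Cn_eq (IH _ _ (Df i) (Dg i)) => y Uy; rewrite partialD //.
  by have [_] := df y Uy.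
by have [_] := dg y Uy.
Qed.

Lemma CnM n f g : Cn n f -> Cn n g -> Cn n (fun x => f x * g x).
Proof.
elim: n f g => // n IH f g Hf Hg.
have /= [df Df] := Hf; have /= [dg Dg] := Hg; split=> [x Ux|i].
  have [cf derf] := df x Ux; have [cg derg] := dg x Ux.
  by split=> [|i]; [apply: (cvgM cf cg)|exact: (derivableM (derf i) (derg i))].
have := CnD (IH _ _ (Df i) (CnW Hg)) (IH _ _ (CnW Hf) (Dg i)).
apply: Cn_eq => y Uy; rewrite partialM //.
  by have [_] := df y Uy.
by have [_] := dg y Uy.
Qed.

Lemma CinfD f g : Cinf f -> Cinf g -> Cinf (fun x => f x + g x).
Proof. by move=> sf sg n; exact: CnD. Qed.

Lemma CinfM f g : Cinf f -> Cinf g -> Cinf (fun x => f x * g x).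
Proof. by move=> sf sg n; exact: CnM. Qed.

Lemma Cinf_cst (c : R) : Cinf (fun=> c).
Proof. by move=> n; exact: Cn_cst. Qed.

Lemma CinfN f : Cinf f -> Cinf (fun x => - f x).
Proof.
move=> sf n; apply: Cn_eq (CinfM (Cinf_cst (-1)) sf n) => y _.
by rewrite mulN1r.
Qed.

Lemma CinfB f g : Cinf f -> Cinf g -> Cinf (fun x => f x - g x).
Proof. by move=> sf sg; apply: CinfD => //; exact: CinfN. Qed.

Lemma Cinf_sum (I : Type) (r : seq I) (f : I -> 'rV[R]_2 -> R) :
  (forall i, Cinf (f i)) -> Cinf (fun x => \sum_(i <- r) f i x).
Proof.
move=> sf; elim: r => [|i r IH] n.
  by apply: Cn_eq (Cn_cst n 0) => y _; rewrite big_nil.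
by apply: Cn_eq (CinfD (sf i) IH n) => y _; rewrite big_cons.
Qed.

Lemma Cinf_eq f g : (forall y, U y -> f y = g y) -> Cinf f -> Cinf g.
Proof. by move=> fg sf n; exact: Cn_eq (sf n). Qed.

Lemma Cinf_partial f i : Cinf f -> Cinf (partial f i).
Proof. by move=> sf n; have [_] := sf n.+1; exact. Qed.

Lemma Cinf_derivable f i x : Cinf f -> U x -> derivable f x (delta_mx 0 i).
Proof. by move=> sf Ux; have /= [/(_ x Ux) [_]] := sf 1; exact. Qed.

Lemma Cinf_cont f x : Cinf f -> U x -> f @ x --> f x.
Proof. by move=> sf Ux; have /= [/(_ x Ux) []] := sf 1. Qed.

Lemma CinfV f : (forall x, U x -> f x != 0) -> Cinf f -> Cinf (fun x => (f x)^-1).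
Proof.
move=> f0 sf n; elim: n => //= n IH; split=> [x Ux|i].
  split=> [|i]; first by apply: (cvgV (f0 x Ux) (Cinf_cont sf Ux)).
  exact: (derivableV (f0 x Ux) (Cinf_derivable sf Ux)).
have := CnM (CnM (Cn_cst n (-1)) (Cinf_partial i sf n)) (CnM IH IH).
apply: Cn_eq => y Uy.
rewrite /partial deriveV ?f0//; last exact: Cinf_derivable.
by rewrite /GRing.scale /= expr2 invfM; ring.
Qed.

(** The chain rule, obtained by restricting [f] to the line through [x] in
    direction [v]. *)
Lemma is_derive_sqrt_comp f x v : 0 < f x -> derivable f x v ->
  is_derive x v (fun y => Num.sqrt (f y)) ((2 * Num.sqrt (f x))^-1 * 'D_v f x).
Proof.
move=> f0 df; pose h (t : R) := f (t *: v + x).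
have dh : derivable h 0 1 := (derivable1P f x v).1 df.
have h0 : h 0 = f x by rewrite /h scale0r add0r.
have dsq : derivable (Num.sqrt : R -> R) (h 0) 1.
  by rewrite h0; apply: ex_derive; exact: is_derive1_sqrt.
have Dline (g : 'rV[R]_2 -> R) : 'D_v g x = 'D_1 (fun t : R => g (t *: v + x)) 0.
  rewrite /derive; set g1 := fun h => h^-1 *: _; set g2 := fun h => h^-1 *: _.
  suff -> : g1 = g2 by [].
  by rewrite funeqE /g1 /g2 => t /=; rewrite addr0 scale0r add0r [_%:A]mulr1.
apply: DeriveDef.
  apply: (derivable1P (fun y => Num.sqrt (f y)) x v).2; apply/derivable1_diffP.
  apply: (@differentiable_comp _ _ _ _ h (Num.sqrt : R -> R)).
    exact/derivable1_diffP.
  exact/derivable1_diffP.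
rewrite (Dline (fun y => Num.sqrt (f y))) -derive1E.
rewrite [LHS](derive1_comp dh dsq) !derive1E h0 derive_sqrt//.
by rewrite Dline.
Qed.

Lemma Cinf_sqrt f : (forall x, U x -> 0 < f x) -> Cinf f ->
  Cinf (fun x => Num.sqrt (f x)).
Proof.
move=> f0 sf n; elim: n => // n IH.
have s0 x : U x -> 2 * Num.sqrt (f x) != 0.
  by move=> Ux; rewrite mulf_neq0 ?pnatr_eq0// gt_eqF ?sqrtr_gt0 ?f0.
have dsq x i : U x -> is_derive x (delta_mx 0 i) (fun y => Num.sqrt (f y))
    ((2 * Num.sqrt (f x))^-1 * partial f i x).
  by move=> Ux; apply: is_derive_sqrt_comp; [exact: f0|exact: Cinf_derivable].
split=> [x Ux|i].
  split=> [|i]; last by apply: ex_derive; exact: dsq.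
  apply: (@continuous_comp _ _ _ f Num.sqrt).
    exact: Cinf_cont.
  exact: sqrt_continuous.
have := CnM (CnM (Cn_cst n (2^-1)) IH) (CnM (CinfV _ sf n) (Cinf_partial i sf n)).
have f0' x : U x -> f x != 0 by move=> Ux; rewrite gt_eqF ?f0.
move=> /(_ f0'); apply: Cn_eq => y Uy.
rewrite [RHS](derive_val (is_derive := dsq y i Uy)) -/(partial f i y).
rewrite -{2}(sqr_sqrtr (ltW (f0 y Uy))); field.
by have := s0 y Uy; rewrite mulf_eq0 negb_or => /andP[_ ->].
Qed.

End SmoothFunctions.

(** * Symmetry of second derivatives *)

Section Schwarz.
Context {R : realType} (U : set 'rV[R]_2).
Hypothesis openU : open U.
Implicit Types (g : 'rV[R]_2 -> R) (x : 'rV[R]_2) (i j : 'I_2).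

Let e i : 'rV[R]_2 := delta_mx 0 i.

Lemma is_derive_line g i x (s : R) : Cinf U g -> U (x + s *: e i) ->
  is_derive s 1 (fun t : R => g (x + t *: e i)) (partial g i (x + s *: e i)).
Proof.
move=> sg Us.
have /derivableP := Cinf_derivable (i := i) sg Us.
move=> [dg dE]; rewrite /partial.
have E : (fun t : R => g (t *: e i + (x + s *: e i))) =
         (fun t : R => (fun t : R => g (x + t *: e i)) (t *: 1 + s)).
  apply: funext => t; congr (g _).
  by rewrite [t *: 1]mulr1 scalerDl addrCA.
have E' : (fun h : R => h^-1 *: ((g \o shift (x + s *: e i)) (h *: e i)
            - g (x + s *: e i))) =
     (fun h : R => h^-1 *: (((fun t : R => g (x + t *: e i)) \o shift s) (h *: 1)
            - g (x + s *: e i))).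
  apply: funext => h; congr (_ *: (_ - _)).
  by have := congr1 (fun f => f h) E.
apply: DeriveDef.
  by move: dg; rewrite /derivable -/(e i) E'.
by rewrite /derive -/(e i) E'.
Qed.

Lemma mvt_line g i x (h : R) : 0 < h -> Cinf U g ->
  (forall s : R, s \in `[0, h] -> U (x + s *: e i)) ->
  exists2 s, s \in `]0, h[ &
    g (x + h *: e i) - g x = h * partial g i (x + s *: e i).
Proof.
move=> h0 sg Us.
have D (s : R) : s \in `[0, h] -> is_derive s 1 (fun t : R => g (x + t *: e i))
    (partial g i (x + s *: e i)) by exact: (fun sh => is_derive_line sg (Us s sh)).
have cont : {within `[0, h], continuous (fun t : R => g (x + t *: e i))}.
  by apply: derivable_within_continuous => s sh; case: (D s sh).
have D' s (sh : s \in `]0, h[) := D s (subset_itv_oo_cc sh).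
have [s sh E] := MVT h0 D' cont.
by exists s => //; move: E; rewrite scale0r addr0 subr0 mulrC.
Qed.

(** The mean value theorem in direction [e i], applied to the increment of [g]
    in direction [e j], and then once more in direction [e j]. The left-hand
    side is symmetric in [i] and [j], the right-hand side is not: this is what
    makes mixed derivatives commute. *)
Lemma second_difference g i j x (h : R) : 0 < h -> Cinf U g ->
  (forall s t : R, s \in `[0, h] -> t \in `[0, h] ->
    U (x + s *: e i + t *: e j)) ->
  exists2 y, (exists s t : R,
      [/\ s \in `[0, h], t \in `[0, h] & y = x + s *: e i + t *: e j]) &
    g (x + h *: e i + h *: e j) - g (x + h *: e i) - g (x + h *: e j) + g x =
    h ^+ 2 * partial (partial g i) j y.
Proof.
move=> h0 sg Uh.
have hh : h \in `[0, h] by rewrite in_itv /= lexx ltW.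
have zh : 0 \in `[0, h] by rewrite in_itv /= lexx ltW.
pose phi (s : R) := g (x + h *: e j + s *: e i) - g (x + s *: e i).
have D (s : R) : s \in `[0, h] -> is_derive s 1 phi
    (partial g i (x + h *: e j + s *: e i) - partial g i (x + s *: e i)).
  move=> sh; have Us := Uh _ _ sh zh; have Uhs := Uh _ _ sh hh.
  rewrite scale0r addr0 in Us; rewrite addrAC in Uhs.
  exact: (is_deriveB (is_derive_line sg Uhs) (is_derive_line sg Us)).
have cont : {within `[0, h], continuous phi}.
  by apply: derivable_within_continuous => s sh; case: (D s sh).
have D' s (sh : s \in `]0, h[) := D s (subset_itv_oo_cc sh).
have [s sh E] := MVT h0 D' cont.
have [t th E2] := @mvt_line (partial g i) j (x + s *: e i) h h0
  (Cinf_partial i sg) (fun t => Uh s t (subset_itv_oo_cc sh)).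
exists (x + s *: e i + t *: e j).
  by exists s, t; split => //; apply: subset_itv_oo_cc.
rewrite expr2 -mulrA -E2 mulrC [x + s *: _ + _]addrAC.
move: E; rewrite /phi subr0 !scale0r !addr0 => <-.
by rewrite (addrAC x (h *: e i)); ring.
Qed.

(** On a small enough square both mixed derivatives take, at some point of it,
    the same value: the second difference divided by [h ^+ 2]. By continuity
    they agree in the limit. *)
Lemma partialC g i j x : Cinf U g -> U x ->
  partial (partial g i) j x = partial (partial g j) i x.
Proof.
move=> sg Ux; apply/eqP; rewrite -subr_eq0 -normr_eq0; apply/negPn/negP => ne0.
have [eps eps0 epsE] : exists2 eps : R, 0 < eps &
    `|partial (partial g i) j x - partial (partial g j) i x| = eps + eps.
  by exists (`|partial (partial g i) j x - partial (partial g j) i x| / 2);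
    [rewrite divr_gt0// lt_def ne0 normr_ge0|exact: splitr].
have c1 : partial (partial g i) j @ x --> partial (partial g i) j x.
  by apply: (Cinf_cont (U := U)) => //; do 2 apply: Cinf_partial.
have c2 : partial (partial g j) i @ x --> partial (partial g j) i x.
  by apply: (Cinf_cont (U := U)) => //; do 2 apply: Cinf_partial.
have n1 : \forall y \near x,
    `|partial (partial g i) j x - partial (partial g i) j y| < eps.
  exact: ((cvgrPdist_lt _ _).1 c1 _ eps0).
have n2 : \forall y \near x,
    `|partial (partial g j) i x - partial (partial g j) i y| < eps.
  exact: ((cvgrPdist_lt _ _).1 c2 _ eps0).
have n0 : \forall y \near x, U y by exact: open_nbhs_nbhs.
have FF := @nbhs_filter ('rV[R]_2 : topologicalType) x.
have n3 := @filterI _ _ FF _ _ (@filterI _ _ FF _ _ n1 n2) n0.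
have [r /= r0 Br] := (nbhs_ballP (M := ('rV[R]_2 : normedModType R)) _ _).1 n3.
(* The side [h] is such that the square spanned at [x] lies in the ball of
   radius [r]. *)
pose m := `|e i| + `|e j| + 1.
have m0 : 0 < m by rewrite ltr_wpDl// addr_ge0.
pose h := r / m / 2.
have h0 : 0 < h by rewrite !divr_gt0.
have B s t : s \in `[0, h] -> t \in `[0, h] ->
    ball x r (x + s *: e i + t *: e j).
  rewrite !in_itv /= => /andP[s0 sh] /andP[t0 th].
  rewrite -ball_normE /ball_ /= -addrA opprD addNKr normrN.
  apply: le_lt_trans (ler_normD _ _) _; rewrite !normrZ !ger0_norm//.
  apply: (@le_lt_trans _ _ (h * m)).
    rewrite /m !mulrDr mulr1 -[leLHS]addr0; apply: lerD; last exact: ltW.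
    by apply: lerD; apply: ler_wpM2r.
  by rewrite /h mulrAC divfK ?gt_eqF// ltr_pdivrMr// mulrDr mulr1 ltrDl.
have [|y [s [t [sh th yE]]] E1] := @second_difference g i j x h h0 sg.
  by move=> s t sh th; have [] := Br _ (B s t sh th).
have [|y' [t' [s' [th' sh' y'E]]] E2] := @second_difference g j i x h h0 sg.
  by move=> t' s' th' sh'; rewrite addrAC; have [] := Br _ (B s' t' sh' th').
have [|[P1 _] _] := Br y; first by rewrite yE; exact: B.
have [|[_ P2] _] := Br y'; first by rewrite y'E addrAC; exact: B.
have EE : partial (partial g i) j y = partial (partial g j) i y'.
  apply: (mulfI (x := h ^+ 2)); first by rewrite expf_neq0 ?gt_eqF.
  apply: (eq_trans (esym E1)); apply: (eq_trans _ E2).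
  rewrite [x + h *: e j + _]addrAC; congr (_ + _).
  by rewrite [LHS]addrAC.
have {}P2 := eq_ind_r
  (fun z => `|partial (partial g j) i x - z| < eps) P2 EE.
rewrite distrC in P2.
have := le_lt_trans (ler_distD (partial (partial g i) j y) _ _) (ltrD P1 P2).
by rewrite epsE ltxx.
Qed.

End Schwarz.

(** * Scalar products, vector fields and brackets *)

Section DotProduct.
Context {R : realType} (n : nat).
Implicit Types (u v w : 'rV[R]_n) (a : R).

Lemma dotvE u v : dotv u v = \sum_k u 0 k * v 0 k.
Proof. by rewrite /dotv mxE; apply: eq_bigr => k _; rewrite mxE. Qed.

Lemma dotvC u v : dotv u v = dotv v u.
Proof. by rewrite !dotvE; apply: eq_bigr => k _; rewrite mulrC. Qed.

Lemma dotvDl u v w : dotv (u + v) w = dotv u w + dotv v w.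
Proof. by rewrite /dotv mulmxDl mxE. Qed.

Lemma dotvZl a u w : dotv (a *: u) w = a * dotv u w.
Proof. by rewrite /dotv -scalemxAl mxE. Qed.

Lemma dotvNl u w : dotv (- u) w = - dotv u w.
Proof. by rewrite -scaleN1r dotvZl mulN1r. Qed.

Lemma dotvBl u v w : dotv (u - v) w = dotv u w - dotv v w.
Proof. by rewrite dotvDl dotvNl. Qed.

Lemma dotvDr w u v : dotv w (u + v) = dotv w u + dotv w v.
Proof. by rewrite dotvC dotvDl !(dotvC _ w). Qed.

Lemma dotvZr a w u : dotv w (a *: u) = a * dotv w u.
Proof. by rewrite dotvC dotvZl (dotvC _ w). Qed.

Lemma dot0v w : dotv 0 w = 0.
Proof. by rewrite /dotv mul0mx mxE. Qed.

Lemma dotv_suml (I : Type) (r : seq I) (F : I -> 'rV[R]_n) w :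
  dotv (\sum_(i <- r) F i) w = \sum_(i <- r) dotv (F i) w.
Proof.
by elim/big_rec2: _ => [|i _ y _ <-]; rewrite ?dot0v ?dotvDl.
Qed.

Lemma dotv_ge0 u : 0 <= dotv u u.
Proof. by rewrite dotvE sumr_ge0// => k _; rewrite -expr2 sqr_ge0. Qed.

Lemma dotv_eq0 u : dotv u u = 0 -> u = 0.
Proof.
rewrite dotvE => /eqP; rewrite psumr_eq0; last first.
  by move=> k _; rewrite -expr2 sqr_ge0.
move=> /allP u0; apply/rowP => k; rewrite mxE.
by have := u0 k; rewrite mem_index_enum -expr2 sqrf_eq0 => /(_ isT) /eqP.
Qed.

(** The matrix of an orthonormal family of the right size is orthogonal on
    both sides. *)
Lemma orthonormal_expansion (e : 'I_n -> 'rV[R]_n) u :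
  (forall i j, dotv (e i) (e j) = (i == j)%:R) ->
  u = \sum_i dotv u (e i) *: e i.
Proof.
move=> ee; pose K : 'M[R]_n := \matrix_(i, k) e i 0 k.
have KKt : K *m K^T = 1%:M.
  apply/matrixP => i j; rewrite !mxE -ee dotvE; apply: eq_bigr => k _.
  by rewrite !mxE.
have KtK := mulmx1C KKt.
apply/rowP => k; rewrite -[u in LHS]mulmx1 -KtK mulmxA mxE summxE.
apply: eq_bigr => i _; rewrite !mxE; congr (_ * _).
by rewrite dotvE; apply: eq_bigr => l _; rewrite !mxE.
Qed.

End DotProduct.

Definition lie {R : realType} (X : 'rV[R]_2 -> 'rV[R]_2) (g : 'rV[R]_2 -> R)
  (x : 'rV[R]_2) : R := \sum_i X x 0 i * partial g i x.

Definition lieV {R : realType} (X : 'rV[R]_2 -> 'rV[R]_2) n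
    (u : 'rV[R]_2 -> 'rV[R]_n) (x : 'rV[R]_2) : 'rV[R]_n :=
  \row_j lie X (fun y => u y 0 j) x.

Definition Cinfv {R : realType} (U : set 'rV[R]_2) n (u : 'rV[R]_2 -> 'rV[R]_n) :=
  forall j, Cinf U (fun x => u x 0 j).

Section VectorFields.
Context {R : realType} (U : set 'rV[R]_2).
Hypothesis openU : open U.
Implicit Types (f g : 'rV[R]_2 -> R) (x : 'rV[R]_2) (X Y : 'rV[R]_2 -> 'rV[R]_2).

Lemma lie_eq X f g x : (forall y, U y -> f y = g y) -> U x ->
  lie X f x = lie X g x.
Proof.
move=> fg Ux; apply: eq_bigr => i _; congr (_ * _).
exact: (partial_eq openU).
Qed.

Lemma lie_cst X (c : R) x : lie X (fun=> c) x = 0.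
Proof.
by rewrite /lie big1// => i _; rewrite /partial derive_cst mulr0.
Qed.

Lemma lieD X f g x : Cinf U f -> Cinf U g -> U x ->
  lie X (fun y => f y + g y) x = lie X f x + lie X g x.
Proof.
move=> sf sg Ux; rewrite /lie -big_split; apply: eq_bigr => i _ /=.
rewrite partialD ?mulrDr//; exact: (Cinf_derivable (U := U)).
Qed.

Lemma lieM X f g x : Cinf U f -> Cinf U g -> U x ->
  lie X (fun y => f y * g y) x = lie X f x * g x + f x * lie X g x.
Proof.
move=> sf sg Ux; rewrite /lie mulr_suml mulr_sumr -big_split.
apply: eq_bigr => i _ /=; rewrite partialM.
- by ring.
- exact: (Cinf_derivable (U := U)).
- exact: (Cinf_derivable (U := U)).
Qed.

Lemma lieZ X (c : R) f x : Cinf U f -> U x ->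
  lie X (fun y => c * f y) x = c * lie X f x.
Proof.
by move=> sf Ux; rewrite lieM ?lie_cst ?mul0r ?add0r//; exact: Cinf_cst.
Qed.

Lemma lie_sum (I : Type) (r : seq I) X (f : I -> 'rV[R]_2 -> R) x :
  (forall i, Cinf U (f i)) -> U x ->
  lie X (fun y => \sum_(i <- r) f i y) x = \sum_(i <- r) lie X (f i) x.
Proof.
move=> sf Ux; elim: r => [|i r IH].
  rewrite big_nil -[RHS](lie_cst X 0 x); apply: lie_eq => // y _.
  by rewrite big_nil.
rewrite big_cons -IH -lieD//; last exact: Cinf_sum.
by apply: lie_eq => // y _; rewrite big_cons.
Qed.

Lemma Cinf_lie X g : Cinfv U X -> Cinf U g -> Cinf U (lie X g).
Proof.
by move=> sX sg; apply: Cinf_sum => // i; apply: CinfM => //; exact: Cinf_partial.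
Qed.

Section Vector.
Context {n : nat}.
Implicit Types u v : 'rV[R]_2 -> 'rV[R]_n.

Lemma Cinf_dotv u v : Cinfv U u -> Cinfv U v -> Cinf U (fun x => dotv (u x) (v x)).
Proof.
move=> su sv; have := Cinf_sum openU (index_enum 'I_n)
  (fun k => CinfM openU (su k) (sv k)).
by apply: Cinf_eq => // y _; rewrite dotvE.
Qed.

Lemma Cinfv_lieV X u : Cinfv U X -> Cinfv U u -> Cinfv U (lieV X u).
Proof.
move=> sX su j; have := Cinf_lie sX (su j).
by apply: Cinf_eq => // y _; rewrite mxE.
Qed.

Lemma CinfvZ f u : Cinf U f -> Cinfv U u -> Cinfv U (fun x => f x *: u x).
Proof.
move=> sf su j; have := CinfM openU sf (su j).
by apply: Cinf_eq => // y _; rewrite mxE.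
Qed.

Lemma CinfvD u v : Cinfv U u -> Cinfv U v -> Cinfv U (fun x => u x + v x).
Proof.
move=> su sv j; have := CinfD openU (su j) (sv j).
by apply: Cinf_eq => // y _; rewrite mxE.
Qed.

Lemma lieV_eq X u v x : (forall y, U y -> u y = v y) -> U x ->
  lieV X u x = lieV X v x.
Proof.
move=> uv Ux; apply/rowP => j; rewrite !mxE.
by apply: lie_eq => // y Uy; rewrite uv.
Qed.

Lemma lieVZ X f u x : Cinf U f -> Cinfv U u -> U x ->
  lieV X (fun y => f y *: u y) x = lie X f x *: u x + f x *: lieV X u x.
Proof.
move=> sf su Ux; apply/rowP => j; rewrite !mxE -lieM//.
by apply: lie_eq => // y _; rewrite mxE.
Qed.

Lemma lieVD X u v x : Cinfv U u -> Cinfv U v -> U x ->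
  lieV X (fun y => u y + v y) x = lieV X u x + lieV X v x.
Proof.
move=> su sv Ux; apply/rowP => j; rewrite !mxE -lieD//.
by apply: lie_eq => // y _; rewrite mxE.
Qed.

Lemma lie_dotv X u v x : Cinfv U u -> Cinfv U v -> U x ->
  lie X (fun y => dotv (u y) (v y)) x =
  dotv (lieV X u x) (v x) + dotv (u x) (lieV X v x).
Proof.
move=> su sv Ux.
rewrite (@lie_eq X _ (fun y => \sum_k u y 0 k * v y 0 k)) //; last first.
  by move=> y _; rewrite dotvE.
rewrite lie_sum//; last by move=> k; exact: CinfM.
by rewrite !dotvE -big_split; apply: eq_bigr => k _ /=; rewrite lieM// !mxE.
Qed.

End Vector.

(** Second-order terms cancel because mixed partial derivatives commute. *)
Lemma lie_bracket X Y g x : Cinfv U X -> Cinfv U Y -> Cinf U g -> U x ->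
  lie X (lie Y g) x - lie Y (lie X g) x =
  lie (fun y => lieV X Y y - lieV Y X y) g x.
Proof.
have expand Z W : Cinfv U Z -> Cinfv U W -> Cinf U g -> U x -> lie Z (lie W g) x =
    \sum_j (lieV Z W x 0 j * partial g j x) +
    \sum_j \sum_i Z x 0 i * W x 0 j * partial (partial g j) i x.
  move=> sZ sW sg Ux; rewrite {2}/lie lie_sum//; last first.
    by move=> j; apply: CinfM => //; exact: Cinf_partial.
  rewrite -big_split; apply: eq_bigr => j _ /=.
  rewrite lieM//; last exact: Cinf_partial.
  rewrite mxE; congr (_ + _); rewrite mulr_sumr; apply: eq_bigr => i _.
  by rewrite mulrCA mulrA.
move=> sX sY sg Ux; rewrite !expand//.
have -> : \sum_j \sum_i X x 0 i * Y x 0 j * partial (partial g j) i x =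
          \sum_j \sum_i Y x 0 i * X x 0 j * partial (partial g j) i x.
  rewrite exchange_big; apply: eq_bigr => i _; apply: eq_bigr => j _ /=.
  by rewrite (partialC openU i j sg Ux) (mulrC (X x 0 i)).
rewrite opprD addrACA subrr addr0 -sumrB; apply: eq_bigr => j _.
by rewrite !mxE mulrBl.
Qed.

(** The commutator of two derivations that span the tangent plane is a
    combination of them, with the same coefficients for all functions. *)
Lemma lie_bracket_span X Y x : Cinfv U X -> Cinfv U Y -> U x ->
  (forall v, exists p q, v = p *: X x + q *: Y x) ->
  exists p q, forall g, Cinf U g ->
    lie X (lie Y g) x - lie Y (lie X g) x = p * lie X g x + q * lie Y g x.
Proof.
move=> sX sY Ux /(_ (lieV X Y x - lieV Y X x)) [p [q B]]; exists p, q => g sg.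
rewrite lie_bracket// {1}/lie B /lie !mulr_sumr -big_split.
by apply: eq_bigr => i _; rewrite !mxE mulrDl !mulrA.
Qed.

(** The flat derivative has no curvature: its commutator along two fields is
    the derivative along their bracket. The Gauss, Codazzi and Ricci equations
    are all instances of this identity, for different pairs of vectors of an
    adapted frame. *)
Lemma structure_equation n X Y p q (u v : 'rV[R]_2 -> 'rV[R]_n) x :
  Cinfv U X -> Cinfv U Y -> Cinfv U u -> Cinfv U v -> U x ->
  (forall g, Cinf U g ->
    lie X (lie Y g) x - lie Y (lie X g) x = p * lie X g x + q * lie Y g x) ->
  lie X (fun y => dotv (lieV Y u y) (v y)) x -
  lie Y (fun y => dotv (lieV X u y) (v y)) x =
  p * dotv (lieV X u x) (v x) + q * dotv (lieV Y u x) (v x) +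
  dotv (lieV Y u x) (lieV X v x) - dotv (lieV X u x) (lieV Y v x).
Proof.
move=> sX sY su sv Ux B; rewrite !lie_dotv//; try exact: Cinfv_lieV.
have -> : lieV X (lieV Y u) x =
    lieV Y (lieV X u) x + (p *: lieV X u x + q *: lieV Y u x).
  apply/rowP => j; have := B _ (su j); rewrite !mxE => <-.
  rewrite (@lie_eq X (fun y => lieV Y u y 0 j) (lie Y (fun y => u y 0 j)))//.
    rewrite (@lie_eq Y (fun y => lieV X u y 0 j) (lie X (fun y => u y 0 j)))//.
      by ring.
    by move=> y _; rewrite mxE.
  by move=> y _; rewrite mxE.
by rewrite !dotvDl !dotvZl; ring.
Qed.

End VectorFields.

(** * The moving frame of a constant angle surface *)

Definition o0 : 'I_4 := @Ordinal 4 0 isT.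
Definition o1 : 'I_4 := @Ordinal 4 1 isT.
Definition o2 : 'I_4 := @Ordinal 4 2 isT.
Definition o3 : 'I_4 := @Ordinal 4 3 isT.

Lemma sum_ord4 (V : nmodType) (F : 'I_4 -> V) :
  \sum_i F i = F o0 + F o1 + F o2 + F o3.
Proof.
rewrite !big_ord_recr big_ord0 /= add0r.
by do ![congr (_ + _)]; congr (F _); apply: val_inj.
Qed.

Lemma forall_ord4 (P : 'I_4 -> Prop) :
  P o0 -> P o1 -> P o2 -> P o3 -> forall i, P i.
Proof.
move=> P0 P1 P2 P3 [[|[|[|[|//]]]] i4].
- by have -> : Ordinal i4 = o0 by exact: val_inj.
- by have -> : Ordinal i4 = o1 by exact: val_inj.
- by have -> : Ordinal i4 = o2 by exact: val_inj.
- by have -> : Ordinal i4 = o3 by exact: val_inj.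
Qed.

Section MovingFrame.
Context {R : realType} (U : set 'rV[R]_2).
Hypothesis openU : open U.
Variables X Y : 'rV[R]_2 -> 'rV[R]_2.
Hypotheses (sX : Cinfv U X) (sY : Cinfv U Y).
Variable e : 'I_4 -> 'rV[R]_2 -> 'rV[R]_4.
Hypothesis se : forall i, Cinfv U (e i).
Hypothesis ee : forall x, U x ->
  forall i j, dotv (e i x) (e j x) = (i == j)%:R.

(** The connection one-forms of the frame [e], evaluated on the field [Z]. *)
Definition connection (Z : 'rV[R]_2 -> 'rV[R]_2) i j x :=
  dotv (lieV Z (e i) x) (e j x).

Lemma parseval x (u v : 'rV[R]_4) : U x ->
  dotv u v =
  dotv u (e o0 x) * dotv v (e o0 x) + dotv u (e o1 x) * dotv v (e o1 x) +
  dotv u (e o2 x) * dotv v (e o2 x) + dotv u (e o3 x) * dotv v (e o3 x).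
Proof.
move=> Ux; rewrite {1}(orthonormal_expansion u (ee Ux)) sum_ord4 !dotvDl.
by rewrite !dotvZl !(dotvC _ v).
Qed.

Lemma connection_anti Z i j x : Cinfv U Z -> U x ->
  connection Z i j x = - connection Z j i x.
Proof.
move=> sZ Ux; apply/eqP; rewrite -addr_eq0; apply/eqP.
rewrite /connection (dotvC (lieV Z (e j) x)) -(lie_dotv openU Z (se i) (se j) Ux).
rewrite (@lie_eq _ _ openU _ _ (fun=> (i == j)%:R)) ?lie_cst// => y Uy.
exact: ee.
Qed.

Lemma connection_diag Z i x : Cinfv U Z -> U x -> connection Z i i x = 0.
Proof.
by move=> sZ Ux; have := connection_anti i i sZ Ux; lra.
Qed.

Lemma Cinf_connection Z i j : Cinfv U Z -> Cinf U (connection Z i j).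
Proof. by move=> sZ; apply: Cinf_dotv => //; exact: Cinfv_lieV. Qed.

(** Second structure equation of the orthonormal frame: the quadratic terms of
    [structure_equation] are expanded in the frame. *)
Lemma cartan i j p q x : U x ->
  (forall g, Cinf U g ->
    lie X (lie Y g) x - lie Y (lie X g) x = p * lie X g x + q * lie Y g x) ->
  lie X (connection Y i j) x - lie Y (connection X i j) x =
  p * connection X i j x + q * connection Y i j x +
  (connection Y i o0 x * connection X j o0 x +
   connection Y i o1 x * connection X j o1 x +
   connection Y i o2 x * connection X j o2 x +
   connection Y i o3 x * connection X j o3 x -
   (connection X i o0 x * connection Y j o0 x +
    connection X i o1 x * connection Y j o1 x +
    connection X i o2 x * connection Y j o2 x +
    connection X i o3 x * connection Y j o3 x)).
Proof.
move=> Ux B; rewrite (structure_equation openU sX sY (se i) (se j) Ux B).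
by rewrite -addrA; congr (_ + (_ - _)); exact: parseval.
Qed.

Variables (c s : R) (tau : 'rV[R]_2 -> R).
Hypothesis stau : Cinf U tau.
Hypotheses (Xtau : forall x, U x -> lie X tau x = s)
           (Ytau : forall x, U x -> lie Y tau x = 0).
Hypotheses (c0 : c != 0) (s0 : s != 0) (cs1 : c ^+ 2 + s ^+ 2 = 1).
Hypothesis XY_span : forall x, U x ->
  forall v, exists p q, v = p *: X x + q *: Y x.
Hypothesis Xe0 : forall x, U x -> lieV X (e o0) x = c *: e o1 x.
Hypothesis Ye0 : forall x, U x -> lieV Y (e o0) x = e o2 x.

Lemma connection_X0 j x : U x -> connection X o0 j x = c * (o1 == j)%:R.
Proof. by move=> Ux; rewrite /connection Xe0// dotvZl ee. Qed.

Lemma connection_Y0 j x : U x -> connection Y o0 j x = (o2 == j)%:R.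
Proof. by move=> Ux; rewrite /connection Ye0// ee. Qed.

Lemma lie_locally_cst Z f (k : R) x : (forall y, U y -> f y = k) -> U x ->
  lie Z f x = 0.
Proof.
by move=> fk Ux; rewrite (@lie_eq _ _ openU _ _ (fun=> k)) ?lie_cst.
Qed.

(** With [e o0] the position in the sphere, [e o1] and [e o2] tangent to the
    projected surface and [e o3] normal to it, these four functions carry the
    whole second fundamental form: in the unit normals [xi] and [eta]
    (horizontal) it sends (X, X) to [c * a * eta], (X, Y) to [c * b * eta] and
    (Y, Y) to [s * y * xi + n * eta]. *)
Let y := connection Y o1 o2.
Let a := connection X o1 o3.
Let b := connection Y o1 o3.
Let n := connection Y o2 o3.

Let connE x (Ux : U x) := (
  fun j => connection_X0 j Ux, fun j => connection_Y0 j Ux,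
  fun i => connection_diag i sX Ux, fun i => connection_diag i sY Ux,
  connection_anti o1 o0 sX Ux, connection_anti o2 o0 sX Ux,
  connection_anti o3 o0 sX Ux, connection_anti o2 o1 sX Ux,
  connection_anti o3 o1 sX Ux, connection_anti o3 o2 sX Ux,
  connection_anti o1 o0 sY Ux, connection_anti o2 o0 sY Ux,
  connection_anti o3 o0 sY Ux, connection_anti o2 o1 sY Ux,
  connection_anti o3 o1 sY Ux, connection_anti o3 o2 sY Ux).

(** First structure equation, that is, the equations of [cartan] on the
    position vector, together with the vanishing of the bracket on [tau]. The
    height function [tau] has constant slopes along both fields, which forces
    the bracket to be a multiple of [Y]. *)
Lemma symmetry_relations x : U x ->
  [/\ connection X o1 o2 x = 0, connection X o2 o3 x = c * b x &
      forall g, Cinf U g -> lie X (lie Y g) x - lie Y (lie X g) x =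
        0 * lie X g x + - (c * y x) * lie Y g x].
Proof.
move=> Ux.
have [p [q B]] := lie_bracket_span openU sX sY Ux (XY_span Ux).
have p0 : p = 0.
  have := B _ stau.
  rewrite (lie_locally_cst Y Xtau Ux) (lie_locally_cst X Ytau Ux).
  rewrite (Xtau Ux) (Ytau Ux) mulr0 addr0 subrr => /esym/eqP.
  by rewrite mulf_eq0 (negbTE s0) orbF => /eqP.
have C j := cartan o0 j Ux B.
have X0 j : lie Y (connection X o0 j) x = 0.
  by apply: lie_locally_cst Ux => z; exact: connection_X0.
have Y0 j : lie X (connection Y o0 j) x = 0.
  by apply: lie_locally_cst Ux => z; exact: connection_Y0.
have := C o1; have := C o2; have := C o3.
rewrite !X0 !Y0 !(connE Ux) -/(y x) -/(b x) p0 /=.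
move=> E3 E2 E1; split.
- by move: E1; lra.
- by move: E3; lra.
- move=> g sg; rewrite B// p0; congr (_ + _ * _).
  by move: E2; lra.
Qed.

(** The equations of [cartan] on the pairs (1, 2), (1, 3) and (2, 3), with the
    relations just found: the Gauss equation and the two Codazzi equations. *)
Lemma gauss_codazzi x : U x ->
  [/\ lie X y x = c * b x ^+ 2 - c * (1 + y x ^+ 2) - a x * n x,
      lie X b x - lie Y a x = - (2 * c * y x * b x) &
      lie X n x - c * lie Y b x = y x * a x - c * y x * n x].
Proof.
move=> Ux; have [X12 X23 B] := symmetry_relations Ux.
have sb : Cinf U b by exact: Cinf_connection.
have E12 := cartan o1 o2 Ux B; have E13 := cartan o1 o3 Ux B.
have E23 := cartan o2 o3 Ux B.
have Z12 : lie Y (connection X o1 o2) x = 0.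
  apply: (lie_locally_cst Y (k := 0)) Ux => z Uz.
  by have [-> _ _] := symmetry_relations Uz.
have Z23 : lie Y (connection X o2 o3) x = c * lie Y b x.
  rewrite -(lieZ openU _ _ sb Ux); apply: (lie_eq openU _ _ Ux) => z.
  by move=> Uz; have [_ -> _] := symmetry_relations Uz.
move: E12 E13 E23; rewrite Z12 Z23 !(connE Ux) X12 X23.
rewrite -/(a x) -/(b x) -/(n x) -/(y x) -/a -/b -/n -/y /=.
move: (lie X y x) (lie X b x) (lie Y a x) (lie X n x) (lie Y b x).
move: (a x) (b x) (n x) (y x) => va vb vn vy Xy Xb Ya Xn Yb E12 E13 E23.
by split; [rewrite -[LHS]subr0 E12 | rewrite E13 | rewrite E23]; ring.
Qed.

(** [sg] is twice the component of the mean curvature vector on the horizontal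
    normal, and [s * y] twice the one on the other normal. The four hypotheses
    below say that this vector is parallel. *)
Let sg x := c * a x + n x.
Hypotheses (Xy : forall x, U x -> lie X y x = - (a x * sg x))
           (Yy : forall x, U x -> lie Y y x = - (b x * sg x))
           (Xsg : forall x, U x -> lie X sg x = s ^+ 2 * (y x * a x))
           (Ysg : forall x, U x -> lie Y sg x = s ^+ 2 * (y x * b x)).

(** Substituting the derivative of [y] given by parallelism makes the Gauss
    equation algebraic. *)
Lemma gauss_parallel x : U x -> a x ^+ 2 + b x ^+ 2 = 1 + y x ^+ 2.
Proof.
move=> Ux; have [G _ _] := gauss_codazzi Ux; move: G; rewrite Xy// /sg.
move: (a x) (b x) (n x) (y x) => va vb vn vy G.
apply: (mulfI c0); apply/eqP.
rewrite -subr_eq0 -(subrr (- (va * (c * va + vn)))) {1}G.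
by apply/eqP; ring.
Qed.

(** A nonzero parallel normal field makes the normal bundle of a surface flat,
    so that its shape operators commute; their commutator is [y * b] up to a
    factor. Here this is read off from commuting derivatives on [sg]. *)
Lemma flat_normal_bundle x : U x -> y x * b x = 0.
Proof.
move=> Ux; have [_ C1 _] := gauss_codazzi Ux.
have [_ _ B] := symmetry_relations Ux.
have [sy sa sb sn] : [/\ Cinf U y, Cinf U a, Cinf U b & Cinf U n].
  by split; exact: Cinf_connection.
have ssg : Cinf U sg by apply: CinfD => //; apply: CinfM => //; exact: Cinf_cst.
have := B _ ssg.
rewrite (lie_eq openU X Ysg Ux) (lie_eq openU Y Xsg Ux).
rewrite Xsg// Ysg//.
have L Z f g : Cinf U f -> Cinf U g -> lie Z (fun z => s ^+ 2 * (f z * g z)) x =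
    s ^+ 2 * (lie Z f x * g x + f x * lie Z g x).
  move=> sf sg'; rewrite (lieZ openU _ _ (CinfM openU sf sg') Ux).
  by rewrite (lieM _ sf sg' Ux).
rewrite (L X y b sy sb) (L Y y a sy sa) (Xy Ux) (Yy Ux); move: C1.
move: (lie X b x) (lie Y a x) (a x) (b x) (sg x) (y x).
move=> Xb Ya va vb vs vy C1 E.
(* The terms in [a * b * sg] cancel, and [C1] turns the rest into a multiple
   of [y ^+ 2 * b]. *)
have : (c * s ^+ 2) * (vy * (vy * vb)) = 0.
  have XbE : Xb = Ya - 2 * c * vy * vb by rewrite -C1 subrKC.
  rewrite XbE in E; apply/eqP; move/eqP: E; rewrite -subr_eq0 -oppr_eq0.
  by congr (_ == 0); ring.
move=> /eqP; rewrite !mulf_eq0 (negbTE c0) (negbTE s0) /=.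
by move=> /orP[/eqP-> | /orP[]/eqP->]; rewrite ?(mul0r, mulr0).
Qed.

(** Since [y * b] vanishes identically, so does its derivative; at points
    where [y] is nonzero this passes to [b] and its derivative along [Y]. *)
Lemma connection_Y13_eq0 x : U x -> y x != 0 -> b x = 0 /\ lie Y b x = 0.
Proof.
move=> Ux y0.
have [sy sb] : Cinf U y /\ Cinf U b by split; exact: Cinf_connection.
have b0 : b x = 0.
  by have /eqP := flat_normal_bundle Ux; rewrite mulf_eq0 (negbTE y0) => /eqP.
split=> //.
have := lie_locally_cst Y flat_normal_bundle Ux.
rewrite (lieM Y sy sb Ux) b0 mulr0 add0r => /eqP.
by rewrite mulf_eq0 (negbTE y0) => /eqP.
Qed.

(** Where [y] is nonzero, the derivative of [gauss_parallel] gives that of [a]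
    along [X]; comparing with the Codazzi equation leaves [2 * c * y * n = 0].
    *)
Lemma connection_Y23_eq0 x : U x -> y x * n x = 0.
Proof.
move=> Ux; have [->|y0] := eqVneq (y x) 0; first by rewrite mul0r.
have [sy sa sb sn] : [/\ Cinf U y, Cinf U a, Cinf U b & Cinf U n].
  by split; exact: Cinf_connection.
have [b0 Yb] := connection_Y13_eq0 Ux y0.
have a0 : a x != 0.
  apply/eqP => a0; have := gauss_parallel Ux.
  rewrite a0 b0 expr0n addr0 => /eqP; rewrite lt_eqF//.
  by rewrite ltr_pwDl// sqr_ge0.
have Xa : lie X a x = - (y x * sg x).
  have := lie_eq openU X gauss_parallel Ux.
  have sq f : Cinf U f -> lie X (fun z => f z ^+ 2) x = 2 * (f x * lie X f x).
    by move=> sf; rewrite [LHS](lieM X sf sf Ux); ring.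
  rewrite (lieD X (CinfM openU sa sa) (CinfM openU sb sb) Ux) !sq//.
  rewrite (lieD X (Cinf_cst openU 1) (CinfM openU sy sy) Ux) lie_cst sq// b0 Xy//.
  rewrite mul0r mulr0 addr0 add0r.
  have two0 : (2 : R) != 0 by rewrite pnatr_eq0.
  by move=> /(mulfI two0) E; apply: (mulfI a0); rewrite E; ring.
have [_ _ C2] := gauss_codazzi Ux.
have := Xsg Ux; rewrite (lieD X (CinfM openU (Cinf_cst openU c) sa) sn Ux).
rewrite (lieZ openU _ _ sa Ux) Xa.
rewrite Yb mulr0 subr0 in C2; rewrite C2 /sg.
have -> : s ^+ 2 = 1 - c ^+ 2 by rewrite -cs1 addrAC subrr add0r.
move: (y x) (a x) (n x) => vy va vn E; apply: (mulfI c0).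
apply: (mulfI (x := - 2)); first by rewrite oppr_eq0 pnatr_eq0.
apply/eqP; move/eqP: E; rewrite -subr_eq0 mulr0 mulr0.
by congr (_ == 0); ring.
Qed.

(** Where [y] is nonzero, both [n] and its derivative along [X] vanish, and
    the Codazzi equation reduces to [y * a = 0]. Then [a] and [b] vanish,
    against [gauss_parallel]. *)
Lemma connection_Y12_eq0 x : U x -> y x = 0.
Proof.
move=> Ux; apply/eqP/negPn/negP => y0.
have [sy sn] : Cinf U y /\ Cinf U n by split; exact: Cinf_connection.
have [b0 Yb] := connection_Y13_eq0 Ux y0.
have n0 : n x = 0.
  by have /eqP := connection_Y23_eq0 Ux; rewrite mulf_eq0 (negbTE y0) => /eqP.
have Xn : lie X n x = 0.
  have := lie_locally_cst X connection_Y23_eq0 Ux.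
  rewrite (lieM X sy sn Ux) n0 mulr0 add0r => /eqP.
  by rewrite mulf_eq0 (negbTE y0) => /eqP.
have [_ _] := gauss_codazzi Ux.
rewrite Xn Yb n0 !mulr0 !subr0 => /esym/eqP.
rewrite mulf_eq0 (negbTE y0) => /eqP a0.
have := gauss_parallel Ux; rewrite a0 b0 expr0n addr0 => /eqP.
by rewrite lt_eqF// ltr_pwDl// sqr_ge0.
Qed.

(** Since [y] vanishes identically, so do its derivatives [- (a * sg)] and [-
    (b * sg)], while [a ^+ 2 + b ^+ 2 = 1]. *)
Lemma mean_curvature_component_eq0 x : U x -> sg x = 0.
Proof.
move=> Ux; apply/eqP/negPn/negP => g0.
have a0 : a x = 0.
  have := lie_locally_cst X connection_Y12_eq0 Ux; rewrite Xy// => /eqP.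
  by rewrite oppr_eq0 mulf_eq0 (negbTE g0) orbF => /eqP.
have b0 : b x = 0.
  have := lie_locally_cst Y connection_Y12_eq0 Ux; rewrite Yy// => /eqP.
  by rewrite oppr_eq0 mulf_eq0 (negbTE g0) orbF => /eqP.
have := gauss_parallel Ux; rewrite a0 b0 expr0n addr0 => /eqP.
by rewrite lt_eqF// ltr_pwDl// sqr_ge0.
Qed.

End MovingFrame.

(** * Derivatives of vector functions, vector products *)

Section Componentwise.
Context {R : realType} (U : set 'rV[R]_2).
Hypothesis openU : open U.

Lemma smooth_on_Cinfv n (F : 'rV[R]_2 -> 'rV[R]_n) : smooth_on U F -> Cinfv U F.
Proof.
move=> sF k m.
suff: forall l, Cn U m (fun x => Defs.iterD l F x 0 k) by move=> /(_ [::]).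
elim: m => // m IH l; split=> [x Ux|i].
  have dx := sF l x Ux; split=> [|i].
    apply: (@continuous_comp _ _ _ (Defs.iterD l F) (fun M : 'rV[R]_n => M 0 k)).
      exact: differentiable_continuous.
    exact: coord_continuous.
  have /derivable_mxP := diff_derivable (v := delta_mx 0 i) dx.
  by apply.
apply: (Cn_eq openU _ (IH (delta_mx 0 i :: l))) => y Uy /=.
rewrite derive_mx; last exact: diff_derivable (sF l y Uy).
by rewrite mxE.
Qed.

Lemma partial_mx n (u : 'rV[R]_2 -> 'rV[R]_n) i x : Cinfv U u -> U x ->
  partial u i x = \row_k partial (fun y => u y 0 k) i x.
Proof.
move=> su Ux; rewrite /partial derive_mx.
  by apply/rowP => k; rewrite !mxE.
apply/derivable_mxP => a k; rewrite (ord1 a).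
exact: (Cinf_derivable (su k) Ux).
Qed.

Lemma Cinfv_partial n (u : 'rV[R]_2 -> 'rV[R]_n) i : Cinfv U u -> Cinfv U (partial u i).
Proof.
move=> su k; apply: (Cinf_eq openU _ (Cinf_partial i (su k))) => y Uy.
by rewrite partial_mx// mxE.
Qed.

Lemma lieVE n Z (u : 'rV[R]_2 -> 'rV[R]_n) x : Cinfv U u -> U x ->
  lieV Z u x = \sum_i Z x 0 i *: partial u i x.
Proof.
move=> su Ux; apply/rowP => k; rewrite mxE summxE; apply: eq_bigr => i _.
by rewrite mxE partial_mx// mxE.
Qed.

Lemma lieV_sum (I : Type) (r : seq I) n Z (u : I -> 'rV[R]_2 -> 'rV[R]_n) x :
  (forall i, Cinfv U (u i)) -> U x ->
  lieV Z (fun y => \sum_(i <- r) u i y) x = \sum_(i <- r) lieV Z (u i) x.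
Proof.
move=> su Ux; apply/rowP => k; rewrite mxE summxE.
rewrite (@lie_eq _ _ openU _ _ (fun y => \sum_(i <- r) u i y 0 k))//.
  rewrite (lie_sum openU _ _ (fun i => su i k) Ux).
  by apply: eq_bigr => i _; rewrite mxE.
by move=> y _; rewrite summxE.
Qed.

(** Differentiating the coefficients of [Z] only contributes tangent terms,
    which [v] does not see. *)
Lemma dotv_lieV_lieV n Z (u : 'rV[R]_2 -> 'rV[R]_n) x v :
  Cinfv U Z -> Cinfv U u -> U x -> (forall i, dotv (partial u i x) v = 0) ->
  dotv (lieV Z (lieV Z u) x) v =
  \sum_i \sum_j Z x 0 i * Z x 0 j * dotv (partial (partial u j) i x) v.
Proof.
move=> sZ su Ux uv.
have spu j := Cinfv_partial j su.
rewrite (@lieV_eq _ _ openU _ _ _ (fun y => \sum_j Z y 0 j *: partial u j y))//.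
  rewrite lieV_sum//; last by move=> j; exact: CinfvZ.
  rewrite dotv_suml exchange_big; apply: eq_bigr => j _ /=.
  rewrite (lieVZ openU _ (sZ j) (spu j) Ux) dotvDl !dotvZl uv mulr0 add0r.
  rewrite lieVE// dotv_suml mulr_sumr; apply: eq_bigr => i _.
  by rewrite dotvZl; ring.
by move=> y Uy; rewrite lieVE.
Qed.

End Componentwise.

Section CrossProduct.
Context {R : realType}.
Implicit Types u v w : 'rV[R]_4.

Definition minor3 u v w (i j k : 'I_4) : R :=
  u 0 i * (v 0 j * w 0 k - v 0 k * w 0 j) -
  u 0 j * (v 0 i * w 0 k - v 0 k * w 0 i) +
  u 0 k * (v 0 i * w 0 j - v 0 j * w 0 i).

(** The vector product of three vectors of a four-dimensional space. *)
Definition cross u v w : 'rV[R]_4 :=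
  \row_l match val l with
         | 0%N => minor3 u v w o1 o2 o3
         | 1%N => - minor3 u v w o0 o2 o3
         | 2%N => minor3 u v w o0 o1 o3
         | _ => - minor3 u v w o0 o1 o2
         end.

Lemma dotv4E u v : dotv u v =
  u 0 o0 * v 0 o0 + u 0 o1 * v 0 o1 + u 0 o2 * v 0 o2 + u 0 o3 * v 0 o3.
Proof. by rewrite dotvE sum_ord4. Qed.

Lemma cross_orth u v w :
  [/\ dotv (cross u v w) u = 0, dotv (cross u v w) v = 0 &
      dotv (cross u v w) w = 0].
Proof. by split; rewrite dotv4E !mxE /= /minor3; ring. Qed.

Lemma cross_gram u v w : dotv (cross u v w) (cross u v w) =
  dotv u u * (dotv v v * dotv w w - dotv v w ^+ 2) -
  dotv u v * (dotv u v * dotv w w - dotv u w * dotv v w) +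
  dotv u w * (dotv u v * dotv v w - dotv v v * dotv u w).
Proof. by rewrite !dotv4E !mxE /= /minor3; ring. Qed.

Lemma Cinfv_cross (U : set 'rV[R]_2) (openU : open U)
    (u v w : 'rV[R]_2 -> 'rV[R]_4) :
  Cinfv U u -> Cinfv U v -> Cinfv U w -> Cinfv U (fun x => cross (u x) (v x) (w x)).
Proof.
move=> su sv sw.
have sm3 i j k : Cinf U (fun x => minor3 (u x) (v x) (w x) i j k).
  have m2 a b : Cinf U (fun x => v x 0 a * w x 0 b - v x 0 b * w x 0 a).
    by apply: CinfB => //; apply: CinfM.
  by apply: CinfD => //; [apply: CinfB => //|]; apply: CinfM.
apply: forall_ord4.
- by apply: (Cinf_eq openU _ (sm3 o1 o2 o3)) => y _; rewrite mxE.
- by apply: (Cinf_eq openU _ (CinfN openU (sm3 o0 o2 o3))) => y _; rewrite mxE.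
- by apply: (Cinf_eq openU _ (sm3 o0 o1 o3)) => y _; rewrite mxE.
- by apply: (Cinf_eq openU _ (CinfN openU (sm3 o0 o1 o2))) => y _; rewrite mxE.
Qed.

End CrossProduct.

(** * The tangent plane of an immersion *)

Section TangentPlane.
Context {R : realType} (F : 'rV[R]_2 -> 'rV[R]_(4 + 1)) (x p q : 'rV[R]_2).
Let T := p *m frame F x.
Let E := q *m frame F x.
Hypotheses (TT : dotv T T = 1) (EE : dotv E E = 1) (TE : dotv T E = 0).

Let P : 'M[R]_(1 + 1, 2) := col_mx p q.

Lemma mx11_dotv (u v : 'rV[R]_(4 + 1)) : u *m v^T = (dotv u v)%:M.
Proof. exact: mx11_scalar. Qed.

(** Orthonormality of [T] and [E], as one matrix equation. *)
Let P_inv : P *m (metric F x *m P^T) = 1%:M.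
Proof.
rewrite /metric !mulmxA -mulmxA -trmx_mul mul_col_mx -/T -/E tr_col_mx.
rewrite mul_col_row !mx11_dotv TT EE TE (dotvC E) TE.
by rewrite scalar_mx_block !raddf0.
Qed.

Lemma invmx_metric : invmx (metric F x) = p^T *m p + q^T *m q.
Proof.
have PPg : (P^T *m P) *m metric F x = 1%:M.
  by rewrite -mulmxA; apply: mulmx1C; rewrite -mulmxA; exact: P_inv.
have [_ gu] := mulmx1_unit PPg.
by rewrite -[LHS]mul1mx -PPg mulmxK// tr_col_mx mul_row_col.
Qed.

Lemma tangent_basis v : exists a b, v = a *: p + b *: q.
Proof.
exists ((v *m metric F x *m p^T) 0 0), ((v *m metric F x *m q^T) 0 0).
have {1}-> : v = v *m (metric F x *m P^T *m P).
  by rewrite (mulmx1C P_inv) mulmx1.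
rewrite tr_col_mx mul_mx_row mul_row_col mulmxDr !mulmxA.
by rewrite [X in X *m p]mx11_scalar [X in X *m q]mx11_scalar !mul_scalar_mx.
Qed.

Lemma tangent_partE w : tangent_part F x w = dotv w T *: T + dotv w E *: E.
Proof.
have row_part (r : 'rV[R]_2) : w *m (frame F x)^T *m (r^T *m r) *m frame F x =
    dotv w (r *m frame F x) *: (r *m frame F x).
  by rewrite -mul_scalar_mx -mx11_dotv trmx_mul !mulmxA.
by rewrite /tangent_part invmx_metric mulmxDr mulmxDl !row_part.
Qed.

Lemma dotv_normal_part w v : dotv T v = 0 -> dotv E v = 0 ->
  dotv (normal_part F x w) v = dotv w v.
Proof.
move=> Tv Ev; rewrite /normal_part tangent_partE dotvBl dotvDl !dotvZl Tv Ev.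
by rewrite !mulr0 addr0 subr0.
Qed.

Lemma normal_part_tangent w :
  dotv (normal_part F x w) T = 0 /\ dotv (normal_part F x w) E = 0.
Proof.
rewrite /normal_part tangent_partE !dotvBl !dotvDl !dotvZl (dotvC E T).
by rewrite TT EE TE !mulr1 !mulr0 addr0 add0r !subrr.
Qed.

Lemma dotv_cov_deriv V i v : dotv (nuS3xR (F x)) v = 0 ->
  dotv (cov_deriv F V i x) v = dotv (partial V i x) v.
Proof.
by move=> nv; rewrite /cov_deriv /projS3xR dotvBl dotvZl nv mulr0 subr0.
Qed.

Lemma dotv_mean_curvature v : dotv (mean_curvature F x) v =
  2^-1 * (\sum_i \sum_j p 0 i * p 0 j * dotv (second_ff F i j x) v +
          \sum_i \sum_j q 0 i * q 0 j * dotv (second_ff F i j x) v).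
Proof.
rewrite /mean_curvature dotvZl dotv_suml -big_split; congr (_ * _).
apply: eq_bigr => i _ /=; rewrite dotv_suml -big_split; apply: eq_bigr => j _ /=.
by rewrite dotvZl invmx_metric !mxE !big_ord1 !mxE mulrDl.
Qed.

(** The second fundamental form takes its values in the normal plane, because
    [normal_part] removes the tangent components and [cov_deriv] the one along
    the normal of the sphere. *)
Lemma mean_curvature_normal : in_S3xR (F x) ->
  (forall i, dotv (partial F i x) (nuS3xR (F x)) = 0) ->
  [/\ dotv (mean_curvature F x) T = 0, dotv (mean_curvature F x) E = 0 &
      dotv (mean_curvature F x) (nuS3xR (F x)) = 0].
Proof.
move=> S1 Fnu.
have nunu : dotv (nuS3xR (F x)) (nuS3xR (F x)) = 1.
  rewrite -[RHS]S1 /nuS3xR /dotv tr_row_mx mul_row_col.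
  by rewrite mul0mx addr0.
have JnuE r : dotv (r *m frame F x) (nuS3xR (F x)) = 0.
  rewrite mulmx_sum_row dotv_suml big1// => i _.
  by rewrite dotvZl rowK Fnu mulr0.
have H0 v : (forall i j, dotv (second_ff F i j x) v = 0) ->
    dotv (mean_curvature F x) v = 0.
  move=> hv; rewrite dotv_mean_curvature !big1 ?addr0 ?mulr0// => i _;
  by rewrite big1// => j _; rewrite hv mulr0.
split; apply: H0 => i j.
- by have [] := normal_part_tangent (cov_deriv F (partial F j) i x).
- by have [] := normal_part_tangent (cov_deriv F (partial F j) i x).
- rewrite /second_ff dotv_normal_part ?JnuE// /cov_deriv /projS3xR.
  by rewrite dotvBl dotvZl nunu mulr1 subrr.
Qed.

End TangentPlane.

(** * Adapted fields of a constant angle surface *)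

Definition vec5 {R : realType} (u : 'rV[R]_4) (k : R) : 'rV[R]_(4 + 1) :=
  row_mx u (const_mx k).

Section ProductSpace.
Context {R : realType}.
Implicit Types (u v : 'rV[R]_4) (k l : R) (p : 'rV[R]_(4 + 1)).

Let last : 'I_(4 + 1) := rshift 4 ord0.

Lemma dotv_vec5 u v k l : dotv (vec5 u k) (vec5 v l) = dotv u v + k * l.
Proof.
by rewrite /dotv /vec5 tr_row_mx mul_row_col mxE; congr (_ + _);
  rewrite mxE big_ord1 !mxE.
Qed.

Lemma vec5_split p : p = vec5 (lsubmx p) (p 0 last).
Proof.
rewrite -[LHS]hsubmxK /vec5; congr row_mx.
by apply/rowP => j; rewrite (ord1 j) !mxE.
Qed.

Lemma nuS3xRE p : nuS3xR p = vec5 (lsubmx p) 0.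
Proof. by []. Qed.

Lemma dtE : dt R = vec5 0 1.
Proof. by rewrite /dt /vec5; congr row_mx; apply/rowP => j; rewrite (ord1 j) !mxE. Qed.

Lemma dotv_dt p : dotv (dt R) p = p 0 last.
Proof.
by rewrite dtE [p in LHS]vec5_split dotv_vec5 dot0v add0r mul1r.
Qed.

Variable U : set 'rV[R]_2.
Hypothesis openU : open U.

Lemma lieV_lsubmx Z (F : 'rV[R]_2 -> 'rV[R]_(4 + 1)) x : U x ->
  lieV Z (fun y => lsubmx (F y)) x = lsubmx (lieV Z F x).
Proof.
move=> Ux; apply/rowP => j; rewrite !mxE; apply: (lie_eq openU) => // y _.
by rewrite mxE.
Qed.

Lemma lieV_vec5 Z (u : 'rV[R]_2 -> 'rV[R]_4) k x : U x ->
  lieV Z (fun y => vec5 (u y) k) x = vec5 (lieV Z u x) 0.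
Proof.
move=> Ux; rewrite [LHS]vec5_split -lieV_lsubmx//; congr vec5.
  by apply: (lieV_eq openU) => // y _; rewrite row_mxKl.
rewrite mxE -[RHS](lie_cst Z k x); apply: (lie_eq openU) => // y _.
by rewrite row_mxEr mxE.
Qed.

Lemma Cinfv_vec5 (u : 'rV[R]_2 -> 'rV[R]_4) k : Cinfv U u ->
  Cinfv U (fun y => vec5 (u y) k).
Proof.
move=> su j; case: (split_ordP j) => i ->.
  by apply: (Cinf_eq openU _ (su i)) => y _; rewrite row_mxEl.
by apply: (Cinf_eq openU _ (Cinf_cst openU k)) => y _; rewrite row_mxEr mxE.
Qed.

Lemma Cinfv_lsubmx (F : 'rV[R]_2 -> 'rV[R]_(4 + 1)) : Cinfv U F ->
  Cinfv U (fun y => lsubmx (F y)).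
Proof.
by move=> sF j; apply: (Cinf_eq openU _ (sF (lshift 1 j))) => y _; rewrite mxE.
Qed.

End ProductSpace.

Lemma sum_ord2 {V : nmodType} (f : 'I_2 -> V) :
  \sum_i f i = f ord0 + f ord_max.
Proof. by rewrite big_ord_recr big_ord1 /=; congr (f _ + _); apply: val_inj. Qed.

Lemma dotv_comb {R : realType} n (u v d : 'rV[R]_n) (a b a' b' : R) :
  dotv (a *: u + b *: v) (a' *: u + b' *: v) =
    a * a' * dotv u u + (a * b' + b * a') * dotv u v + b * b' * dotv v v /\
  [/\ dotv (a *: u + b *: v) u = a * dotv u u + b * dotv u v,
      dotv (a *: u + b *: v) v = a * dotv u v + b * dotv v v &
      dotv d (a *: u + b *: v) = a * dotv d u + b * dotv d v].
Proof.
rewrite !dotvDl !dotvDr !dotvZl !dotvZr (dotvC v u); split=> //.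
by ring.
Qed.

(** The scalar identities behind the two adapted fields. In a plane with Gram
    matrix [g0, g01; g01, g1], the vector of coordinates [w0, w1] is a unit
    vector whose products with the basis are [t0 / s] and [t1 / s], and [q0,
    q1] are the coordinates of the same vector turned by a right angle. *)
Section GramAlgebra.
Context {R : realFieldType}.

Lemma quadratic_formE (g0 g01 g1 w0 w1 : R) :
  w0 ^+ 2 * g0 + 2 * (w0 * w1 * g01) + w1 ^+ 2 * g1 =
  w0 * w0 * g0 + (w0 * w1 + w1 * w0) * g01 + w1 * w1 * g1.
Proof. by ring. Qed.

Lemma degenerate_form (g0 g01 g1 : R) : g0 * g1 - g01 ^+ 2 = 0 ->
  g1 * g1 * g0 + (g1 * - g01 + - g01 * g1) * g01 + - g01 * - g01 * g1 = 0.
Proof. by move=> G0; rewrite -[RHS](mulr0 g1) -G0; ring. Qed.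

Variables g0 g01 g1 s r w0 w1 t0 t1 : R.
Hypothesis w_unit : w0 ^+ 2 * g0 + 2 * (w0 * w1 * g01) + w1 ^+ 2 * g1 = 1.
Hypotheses (t0E : t0 = s * (w0 * g0 + w1 * g01))
           (t1E : t1 = s * (w0 * g01 + w1 * g1)).

Lemma rotated_form :
  t1 * t1 * g0 + (t1 * - t0 + - t0 * t1) * g01 + - t0 * - t0 * g1 =
  s ^+ 2 * (g0 * g1 - g01 ^+ 2).
Proof. by rewrite -[RHS]mulr1 -w_unit t0E t1E; ring. Qed.

Hypotheses (s0 : s != 0) (G0 : g0 * g1 - g01 ^+ 2 != 0).

Lemma cramer0 : (g1 * t0 - g01 * t1) * (s * (g0 * g1 - g01 ^+ 2))^-1 = w0.
Proof.
by apply: (canLR (mulfK _)); rewrite ?mulf_neq0// t0E t1E; ring.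
Qed.

Lemma cramer1 : (g0 * t1 - g01 * t0) * (s * (g0 * g1 - g01 ^+ 2))^-1 = w1.
Proof.
by apply: (canLR (mulfK _)); rewrite ?mulf_neq0// t0E t1E; ring.
Qed.

Hypotheses (r0 : r != 0) (rr : r ^+ 2 = g0 * g1 - g01 ^+ 2).
Let q0 := - t1 * (s * r)^-1.
Let q1 := t0 * (s * r)^-1.

Lemma rotated_unit : q0 * q0 * g0 + (q0 * q1 + q1 * q0) * g01 + q1 * q1 * g1 = 1.
Proof.
rewrite /q0 /q1; apply: (mulfI (x := s ^+ 2 * r ^+ 2)).
  by rewrite mulf_neq0 ?expf_neq0.
rewrite mulr1 [in RHS]rr -rotated_form.
by field; rewrite ?s0 ?r0.
Qed.

Lemma rotated_orth :
  w0 * q0 * g0 + (w0 * q1 + w1 * q0) * g01 + w1 * q1 * g1 = 0.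
Proof. by rewrite /q0 /q1 t0E t1E; field; rewrite ?s0 ?r0. Qed.

Lemma slope_along : w0 * t0 + w1 * t1 = s.
Proof. by rewrite t0E t1E -[RHS]mulr1 -w_unit; ring. Qed.

Lemma slope_orth : q0 * t0 + q1 * t1 = 0.
Proof. by rewrite /q0 /q1; ring. Qed.

End GramAlgebra.

Section AdaptedFields.
Context {R : realType} (U : set 'rV[R]_2).
Hypothesis openU : open U.
Variables (F : 'rV[R]_2 -> 'rV[R]_(4 + 1)) (theta : R).
Hypothesis sF : Cinfv U F.
Hypothesis rkF : forall x, U x -> \rank (frame F x) = 2.
Hypothesis angF : forall x, U x -> has_angle F theta x.
Let s := sin theta.
Let c := cos theta.
Hypothesis s0 : s != 0.

Let A i := partial F i.
Let g i j x := dotv (A i x) (A j x).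
Let t i x := dotv (dt R) (A i x).
Let i0 : 'I_2 := ord0.
Let i1 : 'I_2 := ord_max.

Definition gram x := g i0 i0 x * g i1 i1 x - g i0 i1 x ^+ 2.

(** The field [T] of the decomposition of the vertical vector: the solution,
    by Cramer's rule, of the linear system for its products with the
    coordinate fields. This formula shows that it is smooth. *)
Definition dir_t x : 'rV[R]_2 := \row_j
  ((if j == i0 then g i1 i1 x * t i0 x - g i0 i1 x * t i1 x
    else g i0 i0 x * t i1 x - g i0 i1 x * t i0 x) * (s * gram x)^-1).

(** [dir_t] turned by a right angle: exchanging covariant coordinates with a
    sign and dividing by the area element is the rotation of the plane. *)
Definition dir_orth x : 'rV[R]_2 := \row_j
  ((if j == i0 then - t i1 x else t i0 x) * (s * Num.sqrt (gram x))^-1).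

Lemma row_mul_frame (w : 'rV[R]_2) x :
  w *m frame F x = w 0 i0 *: A i0 x + w 0 i1 *: A i1 x.
Proof. by rewrite mulmx_sum_row sum_ord2 !rowK. Qed.

Lemma lieV_frame Z x : U x -> lieV Z F x = Z x *m frame F x.
Proof.
by move=> Ux; rewrite (lieVE _ sF Ux) row_mul_frame sum_ord2.
Qed.

(** Taking products of the decomposition of the vertical vector with the
    coordinate fields eliminates the unknown normal vector. *)
Lemma angle_coords x : U x -> exists w : 'rV[R]_2,
  [/\ w 0 i0 ^+ 2 * g i0 i0 x + 2 * (w 0 i0 * w 0 i1 * g i0 i1 x) +
        w 0 i1 ^+ 2 * g i1 i1 x = 1,
      t i0 x = s * (w 0 i0 * g i0 i0 x + w 0 i1 * g i0 i1 x) &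
      t i1 x = s * (w 0 i0 * g i0 i1 x + w 0 i1 * g i1 i1 x)].
Proof.
move=> Ux; have [_ [T [xi [/submxP[w TE] TT [_ xiA] _ dtE]]]] := angF Ux.
have comb a b a' b' := dotv_comb (A i0 x) (A i1 x) xi a b a' b'.
exists w; have [ww [wA0 wA1 _]] := comb (w 0 i0) (w 0 i1) (w 0 i0) (w 0 i1).
rewrite -row_mul_frame -TE in ww wA0 wA1; split.
- exact: etrans (quadratic_formE _ _ _ _ _) (etrans (esym ww) TT).
- by rewrite /t dtE dotvDl !dotvZl xiA mulr0 addr0 wA0.
- by rewrite /t dtE dotvDl !dotvZl xiA mulr0 addr0 wA1.
Qed.

Lemma gram_neq0 x : U x -> gram x != 0.
Proof.
move=> Ux; apply/eqP => G0.
have fr : row_free (frame F x) by rewrite /row_free rkF.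
have inj (w : 'rV[R]_2) : w *m frame F x = 0 -> w = 0.
  by move=> wF; apply/eqP; rewrite -(mulmx_free_eq0 w fr) wF.
pose w : 'rV[R]_2 := \row_j (if j == i0 then g i1 i1 x else - g i0 i1 x).
have w0 : w = 0.
  apply: inj; apply: dotv_eq0; rewrite row_mul_frame.
  have [E _] := dotv_comb (A i0 x) (A i1 x) 0 (w 0 i0) (w 0 i1) (w 0 i0) (w 0 i1).
  apply: etrans E _; rewrite !mxE /=; exact: degenerate_form G0.
have A10 : A i1 x = 0.
  by apply: dotv_eq0; have := congr1 (fun v : 'rV[R]_2 => v 0 i0) w0; rewrite !mxE.
have : delta_mx 0 i1 = 0 :> 'rV[R]_2.
  by apply: inj; rewrite -rowE rowK.
move=> /(congr1 (fun v : 'rV[R]_2 => v 0 i1)); rewrite !mxE /= => /eqP.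
by rewrite oner_eq0.
Qed.

(** The rotated vector has squared length [s ^+ 2 * gram], so the Gram
    determinant is nonnegative; it is nonzero by the rank condition. *)
Lemma gram_gt0 x : U x -> 0 < gram x.
Proof.
move=> Ux; rewrite lt_def gram_neq0//=.
have [w [w1 t0E t1E]] := angle_coords Ux.
have := dotv_ge0 (t i1 x *: A i0 x + - t i0 x *: A i1 x).
have [E _] := dotv_comb (A i0 x) (A i1 x) 0 (t i1 x) (- t i0 x)
  (t i1 x) (- t i0 x).
have {E} -> := etrans E (rotated_form w1 t0E t1E).
by rewrite pmulr_rge0// lt_def sqrf_eq0 s0 sqr_ge0.
Qed.

Let sA i : Cinfv U (A i) := Cinfv_partial openU i sF.

Lemma Cinfv_dt : Cinfv U (fun=> dt R).
Proof. by move=> j; exact: Cinf_cst. Qed.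

Lemma Cinf_gram : Cinf U gram.
Proof.
have sg i j : Cinf U (g i j) by exact: Cinf_dotv.
by apply: CinfB => //; apply: CinfM.
Qed.

Lemma Cinfv_dir_t : Cinfv U dir_t.
Proof.
have sg i j : Cinf U (g i j) by exact: Cinf_dotv.
have st i : Cinf U (t i) by exact: (Cinf_dotv openU Cinfv_dt).
have sV : Cinf U (fun x => (s * gram x)^-1).
  apply: CinfV => // [x Ux|]; first by rewrite mulf_neq0// gram_neq0.
  by apply: CinfM => //; [exact: Cinf_cst | exact: Cinf_gram].
have sc i j k i' j' k' : Cinf U (fun x =>
    (g i j x * t k x - g i' j' x * t k' x) * (s * gram x)^-1).
  by apply: CinfM => //; apply: CinfB => //; apply: CinfM.
move=> j; have [->|j0] := eqVneq j i0.
  by apply: (Cinf_eq openU _ (sc i1 i1 i0 i0 i1 i1)) => y _; rewrite mxE eqxx.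
apply: (Cinf_eq openU _ (sc i0 i0 i1 i0 i1 i0)) => y _.
by rewrite mxE (negbTE j0).
Qed.

Lemma Cinfv_dir_orth : Cinfv U dir_orth.
Proof.
have st i : Cinf U (t i) by exact: (Cinf_dotv openU Cinfv_dt).
have sV : Cinf U (fun x => (s * Num.sqrt (gram x))^-1).
  apply: CinfV => // [x Ux|].
    by rewrite mulf_neq0// gt_eqF// sqrtr_gt0 gram_gt0.
  apply: CinfM => //; first exact: Cinf_cst.
  by apply: Cinf_sqrt => //; [exact: gram_gt0 | exact: Cinf_gram].
move=> j; have [->|j0] := eqVneq j i0.
  apply: (Cinf_eq openU _ (CinfM openU (CinfN openU (st i1)) sV)) => y _.
  by rewrite mxE eqxx.
apply: (Cinf_eq openU _ (CinfM openU (st i0) sV)) => y _.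
by rewrite mxE (negbTE j0).
Qed.

Lemma adapted_fields x : U x ->
  [/\ dotv (lieV dir_t F x) (lieV dir_t F x) = 1,
      dotv (lieV dir_orth F x) (lieV dir_orth F x) = 1,
      dotv (lieV dir_t F x) (lieV dir_orth F x) = 0,
      dotv (dt R) (lieV dir_t F x) = s &
      dotv (dt R) (lieV dir_orth F x) = 0].
Proof.
move=> Ux; have [w [w1 t0E t1E]] := angle_coords Ux.
have G0 := gram_neq0 Ux; have Gp := gram_gt0 Ux.
pose r := Num.sqrt (gram x).
have rr : r ^+ 2 = gram x by rewrite sqr_sqrtr// ltW.
have r0 : r != 0 by rewrite gt_eqF// sqrtr_gt0.
have p0 : dir_t x 0 i0 = w 0 i0 by rewrite mxE eqxx; exact: (cramer0 t0E t1E s0 G0).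
have p1 : dir_t x 0 i1 = w 0 i1 by rewrite mxE; exact: (cramer1 t0E t1E s0 G0).
have q0 : dir_orth x 0 i0 = - t i1 x * (s * r)^-1 by rewrite mxE.
have q1 : dir_orth x 0 i1 = t i0 x * (s * r)^-1 by rewrite mxE.
rewrite !lieV_frame// !row_mul_frame p0 p1 q0 q1.
have comb a b a' b' := (dotv_comb (A i0 x) (A i1 x) (dt R) a b a' b').1.
have combd a b := let: And3 _ _ d :=
  (dotv_comb (A i0 x) (A i1 x) (dt R) a b a b).2 in d.
split.
- exact: etrans (comb _ _ _ _) (etrans (esym (quadratic_formE _ _ _ _ _)) w1).
- exact: etrans (comb _ _ _ _) (rotated_unit w1 t0E t1E s0 r0 rr).
- exact: etrans (comb _ _ _ _) (rotated_orth t0E t1E s0 r0).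
- exact: etrans (combd _ _) (slope_along w1 t0E t1E).
- exact: etrans (combd _ _) (slope_orth _ _ _ _).
Qed.

End AdaptedFields.

(** * Constant angle surfaces with parallel mean curvature *)

Section ConstantAngleChart.
Context {R : realType} (U : set 'rV[R]_2).
Hypothesis openU : open U.
Variables (F : 'rV[R]_2 -> 'rV[R]_(4 + 1)) (theta : R).
Hypothesis sF : Cinfv U F.
Hypothesis S1F : forall x, U x -> in_S3xR (F x).
Hypothesis rkF : forall x, U x -> \rank (frame F x) = 2.
Hypothesis angF : forall x, U x -> has_angle F theta x.
Let s := sin theta.
Let c := cos theta.
Hypotheses (s0 : s != 0) (c0 : c != 0).
Let cs1 : c ^+ 2 + s ^+ 2 = 1 := cos2Dsin2 theta.

Let X := dir_t F theta.
Let Y := dir_orth F theta.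
Let sX : Cinfv U X := Cinfv_dir_t openU sF rkF s0.
Let sY : Cinfv U Y := Cinfv_dir_orth openU sF rkF angF s0.
Let fields := adapted_fields sF rkF angF s0.

Definition pos x := lsubmx (F x).
Definition dirX x := c^-1 *: lieV X pos x.
Definition dirY x := lieV Y pos x.
Definition dirN x := cross (pos x) (dirX x) (dirY x).

(** The field [X] projects to [c *: dirX] and [Y] to [dirY]; with the position
    they leave a line of R^4, spanned by the vector product. *)
Definition adapted_frame (i : 'I_4) : 'rV[R]_2 -> 'rV[R]_4 :=
  match val i with 0%N => pos | 1%N => dirX | 2%N => dirY | _ => dirN end.

Let e := adapted_frame.

Let se0 : Cinfv U pos. Proof. exact: Cinfv_lsubmx. Qed.
Let se1 : Cinfv U dirX.
Proof. by apply: (CinfvZ openU (Cinf_cst openU _)); exact: Cinfv_lieV. Qed.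
Let se2 : Cinfv U dirY. Proof. exact: Cinfv_lieV. Qed.
Let se3 : Cinfv U dirN. Proof. exact: Cinfv_cross. Qed.

Lemma Cinfv_adapted_frame i : Cinfv U (e i).
Proof. by move: i; apply: forall_ord4. Qed.
Let se := Cinfv_adapted_frame.

Lemma lieX_F x : U x -> lieV X F x = vec5 (c *: dirX x) s.
Proof.
move=> Ux; have [_ _ _ h _] := fields Ux.
rewrite [LHS]vec5_split -(lieV_lsubmx openU)//; congr vec5.
  by rewrite /dirX scalerA mulfV// scale1r.
by rewrite -dotv_dt.
Qed.

Lemma lieY_F x : U x -> lieV Y F x = vec5 (dirY x) 0.
Proof.
move=> Ux; have [_ _ _ _ h] := fields Ux.
rewrite [LHS]vec5_split -(lieV_lsubmx openU)//; congr vec5.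
by rewrite -dotv_dt.
Qed.

(** The vertical components of [X] and [Y] are [s] and [0], so their
    horizontal parts have squared lengths [1 - s ^+ 2] and [1] and stay
    orthogonal. *)
Lemma orthonormal_adapted_frame x : U x ->
  forall i j, dotv (e i x) (e j x) = (i == j)%:R.
Proof.
move=> Ux; have [TT EE TE _ _] := fields Ux.
have d00 : dotv (pos x) (pos x) = 1 by exact: S1F.
have perp Z : dotv (lieV Z pos x) (pos x) = 0.
  have := lie_dotv openU Z se0 se0 Ux.
  rewrite (lie_locally_cst openU Z (k := 1) _ Ux); last first.
    by move=> z Uz; exact: S1F.
  rewrite (dotvC (pos x)) => /esym/eqP; rewrite -mulr2n mulrn_eq0 /= => /eqP.
  exact.
have d01 : dotv (pos x) (dirX x) = 0.
  by rewrite dotvZr dotvC perp mulr0.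
have d02 : dotv (pos x) (dirY x) = 0 by rewrite dotvC; exact: perp.
have d22 : dotv (dirY x) (dirY x) = 1.
  by have := EE; rewrite (lieY_F Ux) dotv_vec5 mulr0 addr0.
have d11 : dotv (dirX x) (dirX x) = 1.
  have := TT; rewrite (lieX_F Ux) dotv_vec5 dotvZl dotvZr mulrA -!expr2 => E.
  apply: (mulfI (x := c ^+ 2)); first by rewrite expf_neq0.
  by apply: (addIr (s ^+ 2)); rewrite mulr1 [RHS]cs1.
have d12 : dotv (dirX x) (dirY x) = 0.
  have := TE; rewrite (lieX_F Ux) (lieY_F Ux) dotv_vec5 mulr0 addr0 dotvZl.
  by move=> /eqP; rewrite mulf_eq0 (negbTE c0) => /eqP.
have [d30 d31 d32] := cross_orth (pos x) (dirX x) (dirY x).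
have d33 : dotv (dirN x) (dirN x) = 1.
  by rewrite [LHS]cross_gram d00 d01 d02 d11 d12 d22; ring.
have d10 : dotv (dirX x) (pos x) = 0 by rewrite dotvC.
have d20 : dotv (dirY x) (pos x) = 0 by rewrite dotvC.
have d21 : dotv (dirY x) (dirX x) = 0 by rewrite dotvC.
have d03 : dotv (pos x) (dirN x) = 0 by rewrite dotvC.
have d13 : dotv (dirX x) (dirN x) = 0 by rewrite dotvC.
have d23 : dotv (dirY x) (dirN x) = 0 by rewrite dotvC.
by apply: forall_ord4; apply: forall_ord4.
Qed.
Let ee := orthonormal_adapted_frame.

Let tau x := F x 0 (rshift 4 ord0).

Lemma lieX_tau x : U x -> lie X tau x = s.
Proof.
by move=> Ux; have [_ _ _ h _] := fields Ux; rewrite -[RHS]h dotv_dt mxE.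
Qed.

Lemma lieY_tau x : U x -> lie Y tau x = 0.
Proof.
by move=> Ux; have [_ _ _ _ h] := fields Ux; rewrite -[RHS]h dotv_dt mxE.
Qed.

Lemma lieX_pos x : U x -> lieV X (e o0) x = c *: e o1 x.
Proof. by move=> Ux; rewrite /e /= /dirX scalerA mulfV// scale1r. Qed.

Lemma tangent_basis_fields x : U x ->
  [/\ dotv (X x *m frame F x) (X x *m frame F x) = 1,
      dotv (Y x *m frame F x) (Y x *m frame F x) = 1 &
      dotv (X x *m frame F x) (Y x *m frame F x) = 0].
Proof.
move=> Ux; have [TT EE TE _ _] := fields Ux.
by rewrite -!(lieV_frame sF).
Qed.

Lemma span_fields x : U x -> forall v, exists p q, v = p *: X x + q *: Y x.
Proof.
by move=> Ux v; have [TT EE TE] := tangent_basis_fields Ux;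
  exact: (tangent_basis TT EE TE v).
Qed.

Lemma partial_orth x v : U x -> dotv (lieV X F x) v = 0 ->
  dotv (lieV Y F x) v = 0 -> forall i, dotv (partial F i x) v = 0.
Proof.
move=> Ux Xv Yv i; have [p [q pq]] := span_fields Ux (delta_mx 0 i).
have -> : partial F i x = p *: lieV X F x + q *: lieV Y F x.
  rewrite !(lieV_frame sF)// !scalemxAl -mulmxDl -pq -rowE.
  by rewrite rowK.
by rewrite dotvDl !dotvZl Xv Yv !mulr0 addr0.
Qed.

(** The unit normal in the decomposition of the vertical vector: the image
    [vec5 (c *: dirX) s] of [X], turned by a right angle in the plane of
    [dirX] and the vertical vector. *)
Definition xi x := vec5 (- s *: dirX x) c.
Definition eta x := vec5 (dirN x) 0.
Let omega := connection e.
Let y := omega Y o1 o2.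
Let sg x := c * omega X o1 o3 x + omega Y o2 o3 x.
Let H := mean_curvature F.

Lemma normal_frame x : U x ->
  [/\ dotv (nuS3xR (F x)) (xi x) = 0, dotv (nuS3xR (F x)) (eta x) = 0,
      forall i, dotv (partial F i x) (xi x) = 0,
      forall i, dotv (partial F i x) (eta x) = 0 &
      forall i, dotv (partial F i x) (nuS3xR (F x)) = 0].
Proof.
move=> Ux.
have d01 : dotv (pos x) (dirX x) = 0 := ee Ux o0 o1.
have d10 : dotv (dirX x) (pos x) = 0 := ee Ux o1 o0.
have d20 : dotv (dirY x) (pos x) = 0 := ee Ux o2 o0.
have d03 : dotv (pos x) (dirN x) = 0 := ee Ux o0 o3.
have d11 : dotv (dirX x) (dirX x) = 1 := ee Ux o1 o1.
have d21 : dotv (dirY x) (dirX x) = 0 := ee Ux o2 o1.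
have d13 : dotv (dirX x) (dirN x) = 0 := ee Ux o1 o3.
have d23 : dotv (dirY x) (dirN x) = 0 := ee Ux o2 o3.
rewrite nuS3xRE; split; rewrite ?dotv_vec5 -/(pos x).
- by rewrite dotvZr d01 mulr0 mul0r addr0.
- by rewrite d03 mul0r addr0.
- apply: partial_orth => //.
    by rewrite lieX_F// dotv_vec5 dotvZl dotvZr d11; ring.
  by rewrite lieY_F// dotv_vec5 dotvZr d21; ring.
- apply: partial_orth => //.
    by rewrite lieX_F// dotv_vec5 dotvZl d13; ring.
  by rewrite lieY_F// dotv_vec5 d23; ring.
- apply: partial_orth => //.
    by rewrite lieX_F// dotv_vec5 dotvZl d10; ring.
  by rewrite lieY_F// dotv_vec5 d20; ring.
Qed.

Lemma lieXX_F x : U x -> lieV X (lieV X F) x = vec5 (c *: lieV X (e o1) x) 0.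
Proof.
move=> Ux; rewrite (lieV_eq openU X lieX_F Ux) (lieV_vec5 openU)//; congr vec5.
rewrite (lieVZ openU X (Cinf_cst openU c) se1 Ux) lie_cst scale0r add0r.
by [].
Qed.

Lemma lieYY_F x : U x -> lieV Y (lieV Y F) x = vec5 (lieV Y (e o2) x) 0.
Proof.
by move=> Ux; rewrite (lieV_eq openU Y lieY_F Ux) (lieV_vec5 openU).
Qed.

(** The trace with respect to the metric may be computed in the orthonormal
    basis [X], [Y] instead of the coordinate basis. *)
Lemma dotv_H x v : U x -> dotv (nuS3xR (F x)) v = 0 ->
  (forall i, dotv (partial F i x) v = 0) ->
  dotv (H x) v =
  2^-1 * (dotv (lieV X (lieV X F) x) v + dotv (lieV Y (lieV Y F) x) v).
Proof.
move=> Ux nv pv; have [TT EE TE] := tangent_basis_fields Ux.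
have Jv r : dotv (r *m frame F x) v = 0.
  rewrite mulmx_sum_row dotv_suml big1// => i _.
  by rewrite dotvZl rowK pv mulr0.
have h i j : dotv (second_ff F i j x) v = dotv (partial (partial F j) i x) v.
  rewrite /second_ff (dotv_normal_part TT EE TE)//.
  exact: dotv_cov_deriv.
rewrite /H (dotv_mean_curvature TT EE TE) !(dotv_lieV_lieV openU)//.
congr (_ * (_ + _)); apply: eq_bigr => i _; apply: eq_bigr => j _;
by rewrite h.
Qed.

Lemma dotv_H_xi x : U x -> dotv (H x) (xi x) = 2^-1 * (s * y x).
Proof.
move=> Ux; have [nxi _ pxi _ _] := normal_frame Ux; rewrite dotv_H//.
rewrite lieXX_F// lieYY_F// !dotv_vec5 !mul0r !addr0 dotvZl !(dotvZr _ _ (dirX x)).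
rewrite [dotv _ (dirX x)](connection_diag openU se ee o1 sX Ux) !mulr0 add0r.
rewrite [dotv _ (dirX x)](connection_anti openU se ee o2 o1 sY Ux).
by rewrite mulrNN.
Qed.

Lemma dotv_H_eta x : U x -> dotv (H x) (eta x) = 2^-1 * sg x.
Proof.
move=> Ux; have [_ neta _ peta _] := normal_frame Ux; rewrite dotv_H//.
by rewrite lieXX_F// lieYY_F// !dotv_vec5 !mul0r !addr0 dotvZl.
Qed.

(** The difference is orthogonal to the position, to both tangent fields and
    to both normals, which together form an orthonormal basis of R^5. *)
Lemma mean_curvature_expansion x : U x ->
  H x = (2^-1 * (s * y x)) *: xi x + (2^-1 * sg x) *: eta x.
Proof.
move=> Ux; apply/eqP; rewrite -subr_eq0; apply/eqP; set D := _ - _.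
have [nxi neta pxi peta pnu] := normal_frame Ux.
have [TT EE TE] := tangent_basis_fields Ux.
have [HT HE Hnu] := mean_curvature_normal TT EE TE (S1F Ux) pnu.
rewrite -!(lieV_frame sF)// lieX_F// lieY_F// in HT HE.
rewrite nuS3xRE -/(pos x) in nxi neta Hnu.
have O i j : dotv (e i x) (e j x) = (i == j)%:R := ee Ux i j.
have xixi : dotv (xi x) (xi x) = 1.
  by rewrite dotv_vec5 dotvZl (dotvZr _ _ (dirX x)) [dotv _ _](O o1 o1) eqxx mulr1 -[RHS]cs1; ring.
have xieta : dotv (xi x) (eta x) = 0.
  by rewrite dotv_vec5 dotvZl [dotv _ _](O o1 o3) /=; ring.
have etaeta : dotv (eta x) (eta x) = 1.
  by rewrite dotv_vec5 [dotv _ _](O o3 o3) /=; ring.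
have Dv v : dotv D v = dotv (H x) v - (2^-1 * (s * y x) * dotv (xi x) v +
    2^-1 * sg x * dotv (eta x) v).
  by rewrite dotvBl dotvDl (dotvZl _ (xi x)) (dotvZl _ (eta x)).
have Dxi : dotv D (xi x) = 0.
  rewrite Dv dotv_H_xi// xixi (dotvC (eta x)) xieta.
  by rewrite mulr1 mulr0 addr0 subrr.
have Deta : dotv D (eta x) = 0.
  rewrite Dv dotv_H_eta// xieta etaeta.
  by rewrite mulr1 mulr0 add0r subrr.
have Dperp v : dotv (H x) v = 0 -> dotv (xi x) v = 0 -> dotv (eta x) v = 0 ->
    dotv D v = 0.
  by move=> hv xv ev; rewrite Dv hv xv ev !mulr0 addr0 subr0.
have DT : dotv D (vec5 (c *: dirX x) s) = 0.
  apply: Dperp => //.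
    by rewrite dotv_vec5 dotvZl (dotvZr _ _ (dirX x)) [dotv _ _](O o1 o1) /=; ring.
  by rewrite dotv_vec5 (dotvZr _ _ (dirX x)) [dotv _ _](O o3 o1) /=; ring.
have DE : dotv D (vec5 (dirY x) 0) = 0.
  apply: Dperp => //.
    by rewrite dotv_vec5 dotvZl [dotv _ _](O o1 o2) /=; ring.
  by rewrite dotv_vec5 [dotv _ _](O o3 o2) /=; ring.
have Dnu : dotv D (vec5 (pos x) 0) = 0 by apply: Dperp; rewrite // dotvC.
rewrite (vec5_split D) in DT DE Dnu Dxi Deta *.
move: (lsubmx D) (D 0 _) DT DE Dnu Dxi Deta => d k.
rewrite /xi /eta !dotv_vec5 !(dotvZr _ _ (dirX x)) !mulr0 !addr0 => DT DE Dnu Dxi Deta.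
(* [DT] and [Dxi] say that a rotation of the pair formed by the [dirX] and
   vertical components of the difference vanishes. *)
have k0 : k = 0.
  have -> : k = c * (- s * dotv d (dirX x) + k * c) +
                s * (c * dotv d (dirX x) + k * s).
    by rewrite -[LHS]mulr1 -cs1; ring.
  by rewrite Dxi DT !mulr0 addr0.
have m0 : dotv d (dirX x) = 0.
  have -> : dotv d (dirX x) = c * (c * dotv d (dirX x) + k * s) -
                            s * (- s * dotv d (dirX x) + k * c).
    by rewrite -[LHS]mulr1 -cs1; ring.
  by rewrite Dxi DT !mulr0 subr0.
have d0 : d = 0.
  rewrite (orthonormal_expansion d (ee Ux)) sum_ord4.
  rewrite [dotv d (e o0 x)]Dnu [dotv d (e o1 x)]m0 [dotv d (e o2 x)]DE.
  by rewrite [dotv d (e o3 x)]Deta !scale0r !addr0.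
by rewrite d0 k0; exact: row_mx0.
Qed.

Hypothesis parallel_H : forall x, U x -> forall k, normal_conn F H k x = 0.

Let sy : Cinf U y. Proof. exact: Cinf_connection. Qed.
Let ssg : Cinf U sg.
Proof.
apply: CinfD => //; last exact: Cinf_connection.
by apply: (CinfM openU (Cinf_cst openU c)); exact: Cinf_connection.
Qed.
Let sxi : Cinfv U xi.
Proof. by apply: Cinfv_vec5 => //; apply: CinfvZ => //; exact: Cinf_cst. Qed.
Let seta : Cinfv U eta. Proof. exact: Cinfv_vec5. Qed.
Let sA : Cinf U (fun z => 2^-1 * (s * y z)).
Proof. by do 2 apply: (CinfM openU (Cinf_cst openU _)). Qed.
Let sB : Cinf U (fun z => 2^-1 * sg z).
Proof. exact: (CinfM openU (Cinf_cst openU _)). Qed.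

Lemma Cinfv_H : Cinfv U H.
Proof.
have := CinfvD openU (CinfvZ openU sA sxi) (CinfvZ openU sB seta).
move=> h j; apply: (Cinf_eq openU _ (h j)) => z Uz.
by rewrite [in RHS]mean_curvature_expansion.
Qed.

(** Parallelism, in terms of the flat derivative: the latter has no component
    normal to the surface. *)
Lemma dotv_lieV_H Z x v : Cinfv U Z -> U x -> dotv (nuS3xR (F x)) v = 0 ->
  (forall i, dotv (partial F i x) v = 0) -> dotv (lieV Z H x) v = 0.
Proof.
move=> sZ Ux nv pv; have [TT EE TE] := tangent_basis_fields Ux.
have Jv r : dotv (r *m frame F x) v = 0.
  rewrite mulmx_sum_row dotv_suml big1// => i _.
  by rewrite dotvZl rowK pv mulr0.
rewrite (lieVE Z Cinfv_H Ux) dotv_suml big1// => k _; rewrite dotvZl.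
rewrite -(dotv_cov_deriv H k nv) -(dotv_normal_part TT EE TE)//.
have := parallel_H Ux k; rewrite /normal_conn => ->.
by rewrite dot0v mulr0.
Qed.

(** The two normal components of the derivative of the expansion of [H]. *)
Lemma parallel_transport Z x : Cinfv U Z -> U x ->
  lie Z y x = - (omega Z o1 o3 x * sg x) /\
  lie Z sg x = s ^+ 2 * (y x * omega Z o1 o3 x).
Proof.
move=> sZ Ux; have [nxi neta pxi peta _] := normal_frame Ux.
have O i j : dotv (e i x) (e j x) = (i == j)%:R := ee Ux i j.
have E : lieV Z H x =
    (lie Z (fun z => 2^-1 * (s * y z)) x *: xi x +
     2^-1 * (s * y x) *: lieV Z xi x) +
    (lie Z (fun z => 2^-1 * sg z) x *: eta x + 2^-1 * sg x *: lieV Z eta x).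
  rewrite (lieV_eq openU Z mean_curvature_expansion Ux).
  rewrite (lieVD openU Z (CinfvZ openU sA sxi) (CinfvZ openU sB seta) Ux).
  by rewrite (lieVZ openU Z sA sxi Ux) (lieVZ openU Z sB seta Ux).
have Dxi : lieV Z xi x = vec5 (- s *: lieV Z (e o1) x) 0.
  rewrite [LHS](lieV_vec5 openU)//; congr vec5.
  by rewrite (lieVZ openU Z (Cinf_cst openU (- s)) se1 Ux) lie_cst scale0r add0r.
have Deta : lieV Z eta x = vec5 (lieV Z (e o3) x) 0.
  by rewrite [LHS](lieV_vec5 openU).
have DA : lie Z (fun z => 2^-1 * (s * y z)) x = 2^-1 * (s * lie Z y x).
  rewrite (lieZ openU Z _ (CinfM openU (Cinf_cst openU s) sy) Ux).
  by rewrite (lieZ openU Z _ sy Ux).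
have DB : lie Z (fun z => 2^-1 * sg z) x = 2^-1 * lie Z sg x.
  by rewrite (lieZ openU Z _ ssg Ux).
have xixi : dotv (xi x) (xi x) = 1.
  by rewrite dotv_vec5 dotvZl (dotvZr _ _ (dirX x)) [dotv _ _](O o1 o1) eqxx mulr1
    -[RHS]cs1; ring.
have xieta : dotv (xi x) (eta x) = 0.
  by rewrite dotv_vec5 dotvZl [dotv _ _](O o1 o3) /=; ring.
have etaeta : dotv (eta x) (eta x) = 1.
  by rewrite dotv_vec5 [dotv _ _](O o3 o3) /=; ring.
have dxixi : dotv (lieV Z xi x) (xi x) = 0.
  rewrite Dxi dotv_vec5 dotvZl (dotvZr _ _ (dirX x)).
  by rewrite [dotv _ _](connection_diag openU se ee o1 sZ Ux); ring.
have dxieta : dotv (lieV Z xi x) (eta x) = - s * omega Z o1 o3 x.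
  by rewrite Dxi dotv_vec5 dotvZl mul0r addr0.
have detaxi : dotv (lieV Z eta x) (xi x) = s * omega Z o1 o3 x.
  rewrite Deta dotv_vec5 (dotvZr _ _ (dirX x)) mul0r addr0.
  by rewrite [dotv _ _](connection_anti openU se ee o3 o1 sZ Ux) mulrNN.
have detaeta : dotv (lieV Z eta x) (eta x) = 0.
  rewrite Deta dotv_vec5 mul0r addr0.
  exact: (connection_diag openU se ee o3 sZ Ux).
have dotE v : dotv (lieV Z H x) v =
    (2^-1 * (s * lie Z y x) * dotv (xi x) v +
     2^-1 * (s * y x) * dotv (lieV Z xi x) v) +
    (2^-1 * lie Z sg x * dotv (eta x) v + 2^-1 * sg x * dotv (lieV Z eta x) v).
  rewrite E DA DB dotvDl (dotvDl _ (2^-1 * (s * y x) *: lieV Z xi x)).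
  rewrite (dotvDl _ (2^-1 * sg x *: lieV Z eta x)).
  by rewrite (dotvZl _ (xi x)) (dotvZl _ (lieV Z xi x)) (dotvZl _ (eta x))
    (dotvZl _ (lieV Z eta x)).
have two0 : (2 : R) != 0 by rewrite pnatr_eq0.
have := dotv_lieV_H sZ Ux neta peta; have := dotv_lieV_H sZ Ux nxi pxi.
rewrite !dotE xixi dxixi (dotvC (eta x)) xieta etaeta dxieta detaxi detaeta.
move: (lie Z y x) (lie Z sg x) (omega Z o1 o3 x) (sg x) (y x).
move=> Zy Zg a g v E1 E2; split.
  apply: (mulfI s0); apply: (mulfI (invr_neq0 two0)).
  apply/eqP; rewrite -subr_eq0 -E1; apply/eqP; ring.
apply: (mulfI (invr_neq0 two0)).
by apply/eqP; rewrite -subr_eq0 -E2; apply/eqP; ring.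
Qed.

Lemma mean_curvature_eq0 x : U x -> H x = 0.
Proof.
move=> Ux.
have Xy z (Uz : U z) := (parallel_transport sX Uz).1.
have Yy z (Uz : U z) := (parallel_transport sY Uz).1.
have Xsg z (Uz : U z) := (parallel_transport sX Uz).2.
have Ysg z (Uz : U z) := (parallel_transport sY Uz).2.
have lieY_pos z : U z -> lieV Y (e o0) z = e o2 z by [].
have stau : Cinf U tau by exact: sF.
have y0 := connection_Y12_eq0 openU sX sY se ee stau lieX_tau lieY_tau c0 s0 cs1
  span_fields lieX_pos lieY_pos Xy Yy Xsg Ysg Ux.
have g0 := mean_curvature_component_eq0 openU sX sY se ee stau lieX_tau
  lieY_tau c0 s0 cs1 span_fields lieX_pos lieY_pos Xy Yy Xsg Ysg Ux.
rewrite mean_curvature_expansion// [y x]y0 [sg x]g0 !mulr0.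
by rewrite (scale0r (xi x)) (scale0r (eta x)) addr0.
Qed.

End ConstantAngleChart.

Theorem theorem1 (R : realType) (M : topologicalType) (A : smooth_atlas R M)
    (f : M -> 'rV[R]_(4 + 1)) (theta : R) :
  immersed_surface A f ->
  0 < theta < pi / 2 ->
  constant_angle A f theta ->
  parallel_mean_curvature A f ->
  minimal A f.
Proof.
move=> [_ _ fS immf] /andP[th0 th1] ang par i x xU.
have [sf rkf] := immf i.
have s0 : sin theta != 0 by rewrite gt_eqF// sin_gt0_pihalf// th0.
have c0 : cos theta != 0.
  by rewrite gt_eqF// cos_gt0_pihalf// th1 (lt_trans _ th0)// oppr_lt0 divr_gt0// pi_gt0.
have openU : open (chart_img i) by exact: chart_img_open.
apply: (mean_curvature_eq0 openU (smooth_on_Cinfv openU sf) _ rkf (ang i) s0 c0 (par i) xU).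
by move=> y _; exact: fS.
Qed.
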